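(* Let $K\ge2$, let $\pi^0,\pi^1\in(0,1)$ with $\pi^0+\pi^1=1$, and let $T\ge1$. Restricting to the class of blockwise stationary (in particular, for $T=1$, stationary) designs of period $T$ consisting of deterministic decision rules $\phi:\mathcal X\to\mathcal U=\{0,\dots,K-1\}$, there exists an asymptotically optimal design each of whose quantizers is a likelihood ratio threshold rule.
   Context: $\mathbb P_0,\mathbb P_1$ are mutually absolutely continuous probability laws on a space $\mathcal X$ with densities $f^0,f^1$ with respect to a dominating measure. A deterministic decision rule (quantizer) is a measurable map $\phi:\mathcal X\to\mathcal U=\{0,\dots,K-1\}$. Write $f_\phi^i(u)=\mathbb P_i(\phi(X)=u)$, $D_\phi^0:=D(f_\phi^0\|f_\phi^1)$, $D_\phi^1:=D(f_\phi^1\|f_\phi^0)$, with $D(p\|q)=\sum_u p(u)\log\frac{p(u)}{q(u)}$. Standing assumptions on the (non-empty) class $\Phi$ of quantizers considered: $D_\phi^0>0$, $D_\phi^1>0$ for all $\phi\in\Phi$, and $\sup_{\phi\in\Phi}\operatorname{Var}_{f_\phi^i}\log(f_\phi^1/f_\phi^0)<\infty$ for $i=0,1$; here $\Phi$ is the class of all deterministic quantizers into $\mathcal U$ with positive divergences. A blockwise stationary design of period $T$ is a sequence of quantizers with $\phi_{n+T}=\phi_n$. With priors $\pi^0,\pi^1$ and cost per sample $c$, the optimal Bayes sequential cost (expected $c\times$sample size plus probability of error) of such a design behaves like $G\,c\log c^{-1}(1+o(1))$ as $c\to0$, where $$G=\frac{T\pi^0}{D^0_{\phi_1}+\dots+D^0_{\phi_T}}+\frac{T\pi^1}{D^1_{\phi_1}+\dots+D^1_{\phi_T}}.$$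 A design is asymptotically optimal in a class if it minimizes $G$ over that class. Likelihood ratio threshold rule: a quantizer $\phi:\mathcal X\to\{0,\dots,K-1\}$ for which there are thresholds $d_0=-\infty<d_1<\dots<d_K=+\infty$ and a permutation $(u_1,\dots,u_K)$ of $(0,\dots,K-1)$ such that, with $\mathbb P_0$-probability 1, $\phi(X)=u_l$ if $d_{l-1}<f^1(X)/f^0(X)<d_l$ ($l=1,\dots,K$), and for each $l=2,\dots,K$, on the event $f^1(X)/f^0(X)=d_{l-1}$, either $\phi(X)=u_{l-1}$ with $\mathbb P_0$-probability 1 or $\phi(X)=u_l$ with $\mathbb P_0$-probability 1. *)

(* Defs.v *)
(* MathComp-Analysis *)
From HB Require Import structures.
From mathcomp Require Export all_boot all_order all_algebra perm.
From mathcomp Require Export all_classical all_reals all_analysis.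

Set Implicit Arguments.
Unset Strict Implicit.
Unset Printing Implicit Defensive.
Import Order.TTheory GRing.Theory Num.Theory.

Local Open Scope classical_set_scope.
Local Open Scope ring_scope.

Section FiniteLaws.
Context {R : realType} {K : nat}.
Implicit Types p q : 'I_K -> R.

(* Real-valued: faithful when [p u = 0] whenever [q u = 0], as for the laws
   induced by mutually absolutely continuous probabilities. The terms with
   [p u = 0] vanish, which is the convention 0 log (0/q) = 0. *)
Definition kl_div p q : R := \sum_(u < K) p u * ln (p u / q u).

Definition pmf_mean p (h : 'I_K -> R) : R := \sum_(u < K) p u * h u.

Definition pmf_var p (h : 'I_K -> R) : R :=
  \sum_(u < K) p u * (h u - pmf_mean p h) ^+ 2.

End FiniteLaws.

Section Quantizers.
Context {d : measure_display} {X : measurableType d} {R : realType} {K : nat}.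
Implicit Types (phi : X -> 'I_K) (P : probability X R).

Definition is_density (mu : {measure set X -> \bar R}) P (f : X -> R) : Prop :=
  [/\ measurable_fun setT f, forall x, 0 <= f x &
      forall A, measurable A -> P A = (\int[mu]_(x in A) (f x)%:E)%E].

(* Measurability for the discrete sigma-algebra on ['I_K]. *)
Definition quantizer phi : Prop := forall B : set 'I_K, measurable (phi @^-1` B).

Definition induced_pmf P phi (u : 'I_K) : R := fine (P (phi @^-1` [set u])).

Definition div0 (P0 P1 : probability X R) phi : R :=
  kl_div (induced_pmf P0 phi) (induced_pmf P1 phi).

Definition div1 (P0 P1 : probability X R) phi : R :=
  kl_div (induced_pmf P1 phi) (induced_pmf P0 phi).

Definition induced_llr (P0 P1 : probability X R) phi (u : 'I_K) : R :=
  ln (induced_pmf P1 phi u / induced_pmf P0 phi u).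

Definition quantizer_class (P0 P1 : probability X R) : set (X -> 'I_K) :=
  [set phi | [/\ quantizer phi, 0 < div0 P0 P1 phi & 0 < div1 P0 P1 phi]].

Definition bounded_llr_variance (P0 P1 : probability X R)
    (Phi : set (X -> 'I_K)) P : Prop :=
  has_ubound [set pmf_var (induced_pmf P phi) (induced_llr P0 P1 phi)
             | phi in Phi].

(* Designs are indexed from 0: [phi n] is the quantizer used at time n + 1. *)
Definition blockwise_stationary (T : nat) (Phi : set (X -> 'I_K)) :
    set (nat -> X -> 'I_K) :=
  [set phi | (forall n, phi (n + T)%N = phi n) /\ (forall n, Phi (phi n))].

(* The constant G of the asymptotic expansion G c log(1/c) (1 + o(1)), as the
   cost per sample c tends to 0, of the optimal Bayes sequential cost of a
   design of period T. *)
Definition cost_coef (P0 P1 : probability X R) (pi0 pi1 : R)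
    (T : nat) (phi : nat -> X -> 'I_K) : R :=
  T%:R * pi0 / (\sum_(t < T) div0 P0 P1 (phi t))
  + T%:R * pi1 / (\sum_(t < T) div1 P0 P1 (phi t)).

Definition asymptotically_optimal (P0 P1 : probability X R)
    (pi0 pi1 : R) (T : nat) (C : set (nat -> X -> 'I_K)) (phi : nat -> X -> 'I_K) : Prop :=
  C phi /\
  forall psi, C psi ->
    cost_coef P0 P1 pi0 pi1 T phi <= cost_coef P0 P1 pi0 pi1 T psi.

(* [u l] is the label of the l-th cell (l from 0), which lies between
   [thr l] and [thr l.+1]. The value of [f1 x / f0 x] where [f0 x = 0] is
   irrelevant, since that event has P0-probability 0. *)
Definition lr_threshold_rule (P0 : probability X R) (f0 f1 : X -> R) phi : Prop :=
  exists (thr : nat -> \bar R) (u : {perm 'I_K}),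
    [/\ thr 0%N = -oo%E, thr K = +oo%E,
        forall l, (l < K)%N -> (thr l < thr l.+1)%E,
        {ae P0, forall x, forall l : 'I_K,
           (thr l < (f1 x / f0 x)%:E < thr l.+1)%E -> phi x = u l} &
        forall l m : 'I_K, m = l.+1 :> nat ->
          {ae P0, forall x, (f1 x / f0 x)%:E = thr m -> phi x = u l} \/
          {ae P0, forall x, (f1 x / f0 x)%:E = thr m -> phi x = u m}].

End Quantizers.

(* Main.v *)
Require Import Defs.
From mathcomp Require Import ring lra.
From mathcomp Require Import measurable_realfun lebesgue_measure.
Import Order.TTheory GRing.Theory Num.Theory.
Import numFieldNormedType.Exports.
Local Open Scope classical_set_scope.
Local Open Scope ring_scope.
Set Implicit Arguments.
Unset Strict Implicit.
Unset Printing Implicit Defensive.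

(** The cost [G] depends on a quantizer only through the two laws that it induces
    on the labels, and decreases in the divergences. A quantizer is relaxed to an
    [allocation]: the masses [P_i (A and label u)] of a randomised rule, described
    by linear conditions only. Allocations form a compact convex set that contains
    the deterministic rules. The bound on the variances, applied to binary
    quantizers, makes the tails of the log-likelihood ratio so light that labels
    of small mass contribute little to the divergences ([small_label]); hence the
    divergences are upper semicontinuous and an optimal design of allocations
    exists ([exists_optimal_design]). It remains to see that each component of it
    is, up to equality of both divergences, a deterministic threshold rule.

    Fix one component and move mass of likelihood ratio [l] from label v to label
    u. The cost changes at a rate that is affine in [l] and changes sign at one
    point, the crossing of u and v; at an optimum the label of smaller ratio
    therefore lives below the crossing and the other one above it
    ([optimal_crossing_le]). What remains is an atom of the likelihood ratio at
    the crossing itself, which a randomised rule could split. There the rate of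
    change vanishes, but the second derivative is negative ([curvature_lt0]), so
    that moving a part of the atom one way would lower the cost: at an optimum the
    two labels have no mass on the atom ([optimal_atom_null]). When the labels are
    all nonempty with distinct ratios, sorting them by ratio thus exhibits a
    threshold rule with the same label masses ([threshold_rule_exists]).

    Two labels of equal ratio can be merged without change of the divergences. An
    empty label could be used to split a cell, which would increase both
    divergences unless the likelihood ratio is constant on every cell
    ([optimal_pure]); then any thresholds between the finitely many values do.

    The negative second derivative is the quantitative core. The cost is
    [c0 / a + c1 / b] with convex [a] and [b]; at a stationary point their slopes
    have opposite signs, and [a], [b] are at least the divergences lost by merging
    the two cells. Bounding the inverses of these losses through the gap between
    the logarithm and its chord ([ln_chord_gap]) reduces the claim to an
    inequality between the coefficients of the two cell masses
    ([curvature_side]). *)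

(** * Logarithmic inequalities *)

(** The derivative of a member of this family is rational, so that its monotonicity,
    hence an inequality between logarithms and rational functions, is a matter of
    algebra. *)
Definition log_comb (R : realType) (k c0 c1 c2 c3 c4 c5 : R) : R -> R :=
  (c0 *: (fun x => ln (1 + k * x)) + c1 *: (fun x => ln (1 + x)) + c2 *: id
   + c3 *: (id ^+ 2) + c4 *: (id ^+ 3)) + c5 *: (fun x => (1 + k * x)^-1).

Lemma log_combE (R : realType) (k c0 c1 c2 c3 c4 c5 w : R) :
  log_comb k c0 c1 c2 c3 c4 c5 w =
  c0 * ln (1 + k * w) + c1 * ln (1 + w) + c2 * w + c3 * w ^+ 2 + c4 * w ^+ 3
  + c5 * (1 + k * w)^-1.
Proof. by rewrite /log_comb !fctE. Qed.

Lemma is_derive_affine (R : realType) (k w : R) :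
  is_derive w (1:R) (fun x : R => 1 + k * x) k.
Proof.
have h := is_deriveD (@is_derive_cst R R R 1 w 1)
  (@is_deriveZ R R R id k w 1 1 (is_derive_id w 1)).
have e : 0 + k *: (1 : R) = k by rewrite add0r /GRing.scale /= mulr1.
rewrite e in h; exact: h.
Qed.

Lemma is_derive_ln_affine (R : realType) (k w : R) : 0 < 1 + k * w ->
  is_derive w (1 : R) (fun x => ln (1 + k * x)) (k / (1 + k * w)).
Proof.
move=> kw; rewrite mulrC.
exact: (@is_derive1_comp R (@ln R) (fun x : R => 1 + k * x) w _ _
  (is_derive1_ln kw) (is_derive_affine k w)).
Qed.

Lemma is_derive_inv_affine (R : realType) (k w : R) : 0 < 1 + k * w ->
  is_derive w (1 : R) (fun x => (1 + k * x)^-1) (- (k / (1 + k * w) ^+ 2)).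
Proof.
move=> kw; have kw0 : 1 + k * w != 0 by rewrite gt_eqF.
have [df dfE] := is_derive_affine k w.
apply: DeriveDef; first exact: (@derivableV _ _ (fun x : R => 1 + k * x)).
rewrite (@deriveV _ _ (fun x : R => 1 + k * x)) // dfE /GRing.scale /=.
by rewrite mulNr mulrC.
Qed.

Lemma is_derive_log_comb (R : realType) (k c0 c1 c2 c3 c4 c5 w : R) :
  0 < 1 + k * w -> 0 < 1 + w ->
  is_derive w 1 (log_comb k c0 c1 c2 c3 c4 c5)
    (c0 * (k / (1 + k * w)) + c1 / (1 + w) + c2 + 2 * c3 * w + 3 * c4 * w ^+ 2
     - c5 * (k / (1 + k * w) ^+ 2)).
Proof.
move=> kw w1.
have d1 : is_derive w 1 (fun x : R => ln (1 + x)) (1 + w)^-1.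
  have := @is_derive_ln_affine R 1 w.
  rewrite !mul1r => /(_ w1).
  by under [X in is_derive _ _ X _]eq_fun do rewrite mul1r.
have di := is_derive_id w (1 : R).
have h := is_deriveD (is_deriveD (is_deriveD (is_deriveD (is_deriveD
  (is_deriveZ c0 (is_derive_ln_affine kw)) (is_deriveZ c1 d1))
  (is_deriveZ c2 di)) (is_deriveZ c3 (is_deriveX 2 di)))
  (is_deriveZ c4 (is_deriveX 3 di))) (is_deriveZ c5 (is_derive_inv_affine kw)).
apply: (is_derive_eq h).
rewrite /GRing.scale /=; ring.
Qed.

Lemma log_comb_incr (R : realType) (k c0 c1 c2 c3 c4 c5 a b : R) :
  a <= b -> (forall w, a <= w <= b -> 0 < 1 + k * w /\ 0 < 1 + w) ->
  (forall w, a <= w <= b ->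
    0 <= c0 * (k / (1 + k * w)) + c1 / (1 + w) + c2 + 2 * c3 * w
         + 3 * c4 * w ^+ 2 - c5 * (k / (1 + k * w) ^+ 2)) ->
  log_comb k c0 c1 c2 c3 c4 c5 a <= log_comb k c0 c1 c2 c3 c4 c5 b.
Proof.
move=> ab pos dpos.
have dd x : a <= x <= b -> is_derive x 1 (log_comb k c0 c1 c2 c3 c4 c5)
    (c0 * (k / (1 + k * x)) + c1 / (1 + x) + c2 + 2 * c3 * x + 3 * c4 * x ^+ 2
     - c5 * (k / (1 + k * x) ^+ 2)).
  by move=> /pos[? ?]; exact: is_derive_log_comb.
have cf : {within `[a, b], continuous log_comb k c0 c1 c2 c3 c4 c5}.
  apply: derivable_within_continuous => x; rewrite in_itv /= => xab.
  by have [] := dd _ xab.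
have dd' x : x \in `]a, b[ -> is_derive x 1 (log_comb k c0 c1 c2 c3 c4 c5)
    (c0 * (k / (1 + k * x)) + c1 / (1 + x) + c2 + 2 * c3 * x + 3 * c4 * x ^+ 2
     - c5 * (k / (1 + k * x) ^+ 2)).
  by rewrite in_itv /= => /andP[ax xb]; apply: dd; rewrite !ltW.
have [c + e] := MVT_segment ab dd' cf.
rewrite in_itv /= => /dpos c0'.
by rewrite -subr_ge0 e mulr_ge0 // subr_ge0.
Qed.

Lemma log_comb_ge (R : realType) (k c0 c1 c2 c3 c4 c5 z : R) :
  0 <= z -> 0 <= k ->
  (forall w, 0 <= w -> 0 < 1 + k * w -> 0 < 1 + w ->
    0 <= c0 * (k / (1 + k * w)) + c1 / (1 + w) + c2 + 2 * c3 * w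
         + 3 * c4 * w ^+ 2 - c5 * (k / (1 + k * w) ^+ 2)) ->
  c5 <= c0 * ln (1 + k * z) + c1 * ln (1 + z) + c2 * z + c3 * z ^+ 2
    + c4 * z ^+ 3 + c5 * (1 + k * z)^-1.
Proof.
move=> z0 k0 H; have pos w : 0 <= w -> 0 < 1 + k * w /\ 0 < 1 + w.
  by move=> w0; have := mulr_ge0 k0 w0; lra.
have := @log_comb_incr R k c0 c1 c2 c3 c4 c5 0 z z0.
rewrite !log_combE !mulr0 !addr0 ln1 invr1 !expr0n !mulr0 !mulr1 !addr0 !add0r.
by apply=> w /andP[w0 _]; [exact: pos|have [? ?] := pos _ w0; exact: H].
Qed.

Lemma ln_le_sub1 (R : realType) (x : R) : 0 < x -> ln x <= x - 1.
Proof.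
move=> x0; have := @le_ln1Dx R (x - 1).
have -> : 1 + (x - 1) = x by ring.
by apply; lra.
Qed.

Lemma ln_lt_sub1 (R : realType) (x : R) : 0 < x -> x != 1 -> ln x < x - 1.
Proof.
move=> x0 x1; have y0 : 0 < Num.sqrt x by rewrite sqrtr_gt0.
have xE : x = Num.sqrt x ^+ 2 by rewrite sqr_sqrtr // ltW.
move: y0 xE; set y := Num.sqrt x => y0 xE.
have y1 : y != 1 by apply: contra x1 => /eqP y1; rewrite xE y1 expr1n.
have := ln_le_sub1 y0; rewrite xE lnXn // => h.
have : 0 < (y - 1) ^+ 2 by rewrite lt_neqAle sqr_ge0 eq_sym sqrf_eq0 subr_eq0 y1.
by rewrite mulr2n; nra.
Qed.

Lemma ln1D_ge_pade (R : realType) (s : R) : 0 <= s -> 2 * s / (2 + s) <= ln (1 + s).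
Proof.
move=> s0.
have h : 2 <= 0 * ln (1 + 2^-1 * s) + 1 * ln (1 + s) + 0 * s + 0 * s ^+ 2
    + 0 * s ^+ 3 + 2 * (1 + 2^-1 * s)^-1.
  apply: log_comb_ge => [||w w0 p1 p2]; [lra|lra|].
  have -> : 0 * (2^-1 / (1 + 2^-1 * w)) + 1 / (1 + w) + 0 + 2 * 0 * w + 3 * 0 * w ^+ 2
    - 2 * (2^-1 / (1 + 2^-1 * w) ^+ 2)
    = (2^-1 * w) ^+ 2 / ((1 + w) * (1 + 2^-1 * w) ^+ 2).
    by field; rewrite !gt_eqF //; lra.
  by rewrite divr_ge0 ?sqr_ge0 // mulr_ge0 ?sqr_ge0 // ltW.
have e : 2 * s / (2 + s) = 2 - 2 * (1 + 2^-1 * s)^-1.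
  by field; rewrite !gt_eqF //; lra.
by rewrite e; lra.
Qed.

Lemma ln1D_le_sub_inv (R : realType) (h : R) : 0 <= h ->
  2 * ln (1 + h) <= (1 + h) - (1 + h)^-1.
Proof.
move=> h0.
have : -1 <= 0 * ln (1 + 1 * h) + (-2) * ln (1 + h) + 1 * h + 0 * h ^+ 2
    + 0 * h ^+ 3 + (-1) * (1 + 1 * h)^-1.
  apply: log_comb_ge => [||w w0 p1 p2]; [lra|lra|].
  have -> : 0 * (1 / (1 + 1 * w)) + (-2) / (1 + w) + 1 + 2 * 0 * w + 3 * 0 * w ^+ 2
    - (-1) * (1 / (1 + 1 * w) ^+ 2) = (1 - (1 + w)^-1) ^+ 2.
    by field; rewrite !gt_eqF //; lra.
  exact: sqr_ge0.
by rewrite !mul1r; lra.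
Qed.

(** For [w = sqrt y] this is the square of [2 * ln w <= w - w^-1]. In other words the
    geometric mean of 1 and y is at most their logarithmic mean. *)
Lemma sqr_ln_le (R : realType) (y : R) : 1 <= y -> y * ln y ^+ 2 <= (y - 1) ^+ 2.
Proof.
move=> y1; set w := Num.sqrt y.
have yE : y = w ^+ 2 by rewrite sqr_sqrtr //; lra.
have w1 : 1 <= w by rewrite -[1]sqrtr1 ler_wsqrtr.
have w0 : 0 < w by lra.
have := @ln1D_le_sub_inv R (w - 1); have -> : 1 + (w - 1) = w by ring.
move=> /(_ ltac:(lra)) lw.
have l0 : 0 <= ln w by exact: ln_ge0.
rewrite yE lnXn // mulr2n -mulr2n -[_ *+ 2]mulr_natl.
have h : w * (2 * ln w) <= w ^+ 2 - 1.
  have -> : w ^+ 2 - 1 = w * (w - w^-1) by field; rewrite gt_eqF.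
  by rewrite ler_pM2l.
rewrite -exprMn ler_sqr ?nnegrE //; first by rewrite !mulr_ge0 // ltW.
by have := mulr_ge0 (ltW w0) (mulr_ge0 (ler0n R 2) l0); lra.
Qed.

(** The derivative of the difference is [h ^+ 3 / (1 + h)], which has the sign of
    h: the difference is minimal at 0. *)
Lemma ln1D_le_cubic (R : realType) (h : R) : -1 < h ->
  ln (1 + h) <= h - h ^+ 2 / 2 + h ^+ 3 / 3.
Proof.
move=> h1.
have dE (w : R) : -1 < w -> 0 * (0 / (1 + 0 * w)) + (-1) / (1 + w) + 1
    + 2 * (- 2^-1) * w + 3 * 3^-1 * w ^+ 2 - 0 * (0 / (1 + 0 * w) ^+ 2)
    = w ^+ 3 / (1 + w).
  move=> w1; rewrite !mul0r.
  by field; rewrite gt_eqF //; lra.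
have [h0|h0] := leP 0 h.
  have : 0 <= 0 * ln (1 + 0 * h) + (-1) * ln (1 + h) + 1 * h + (- 2^-1) * h ^+ 2
    + 3^-1 * h ^+ 3 + 0 * (1 + 0 * h)^-1.
    apply: log_comb_ge => // w w0 p1 p2; rewrite dE; last lra.
    by rewrite divr_ge0 ?exprn_ge0 // ltW.
  by rewrite !mul0r; lra.
have : log_comb 0 0 1 (-1) 2^-1 (-3^-1) 0 h <= log_comb 0 0 1 (-1) 2^-1 (-3^-1) 0 0.
  apply: log_comb_incr (ltW h0) _ _ => w /andP[hw w0]; first by split; lra.
  have w1 : -1 < w by lra.
  have -> : 0 * (0 / (1 + 0 * w)) + 1 / (1 + w) + -1 + 2 * 2^-1 * w
    + 3 * - 3^-1 * w ^+ 2 - 0 * (0 / (1 + 0 * w) ^+ 2) = - (w ^+ 3 / (1 + w)).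
    by rewrite -dE //; ring.
  have p1 : 0 < (1 + w)^-1 by rewrite invr_gt0; lra.
  rewrite oppr_ge0 (pmulr_lle0 _ p1).
  by rewrite exprSr mulr_ge0_le0 // sqr_ge0.
by rewrite !log_combE !addr0 ln1 !expr0n !mul0r /= !mulr0n; lra.
Qed.

(** The gap between the logarithm and its chord over [1, 1 + z] is [pi * (1 - pi)]
    times the integral of [1 / (1 + pi * w)] against [w / (1 + w)] for w from 0 to
    z. The bound replaces the convex function [1 / x] by its tangent at [lam^-1],
    and [lam] is free to be optimised. *)
Lemma ln_chord_gap (R : realType) (pi z E lam : R) :
  0 <= pi -> pi <= 1 -> 0 <= z -> E = z - ln (1 + z) ->
  pi * (1 - pi) * (2 * lam * E - lam ^+ 2 * ((1 - pi) * E + pi * z ^+ 2 / 2))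
  <= ln (1 + pi * z) - pi * ln (1 + z).
Proof.
move=> pi0 pi1 z0 ->.
pose m := 2 * lam - lam ^+ 2 * (1 - pi).
have : 0 <= 1 * ln (1 + pi * z) + (- pi + pi * (1 - pi) * m) * ln (1 + z)
   + (- (pi * (1 - pi) * m)) * z + (pi * (1 - pi) * lam ^+ 2 * pi / 2) * z ^+ 2
   + 0 * z ^+ 3 + 0 * (1 + pi * z)^-1.
  apply: log_comb_ge => // w w0 p1 p2.
  have -> : 1 * (pi / (1 + pi * w)) + (- pi + pi * (1 - pi) * m) / (1 + w)
    + (- (pi * (1 - pi) * m)) + 2 * (pi * (1 - pi) * lam ^+ 2 * pi / 2) * w
    + 3 * 0 * w ^+ 2 - 0 * (pi / (1 + pi * w) ^+ 2)
    = pi * (1 - pi) * w * (1 - lam * (1 + pi * w)) ^+ 2 / ((1 + w) * (1 + pi * w)).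
    by rewrite /m; field; rewrite !gt_eqF.
  have q0 : 0 <= 1 - pi by rewrite subr_ge0.
  apply: divr_ge0 (mulr_ge0 (ltW p2) (ltW p1)).
  by apply: mulr_ge0 (sqr_ge0 _); rewrite !mulr_ge0.
by rewrite /m; lra.
Qed.

(** * One summand of the divergence *)

Definition kl_term (R : realType) (p q : R) : R := p * ln (p / q).

(** The summand is convex and homogeneous of degree 1, so its tangent along the
    ray of likelihood ratio r is linear; the last term is the distance to it. *)
Lemma kl_term_tangent (R : realType) (p q r : R) : 0 < p -> 0 < q -> 0 < r ->
  kl_term p q = p * (1 - ln r) - q / r + p * (q / (p * r) - 1 - ln (q / (p * r))).
Proof.
move=> p0 q0 r0; rewrite /kl_term !ln_div ?posrE ?mulr_gt0 // lnM //.
by field; rewrite !gt_eqF.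
Qed.

Lemma kl_term_ge_tangent (R : realType) (p q r : R) : 0 < p -> 0 < q -> 0 < r ->
  p * (1 - ln r) - q / r <= kl_term p q.
Proof.
move=> p0 q0 r0; rewrite (kl_term_tangent p0 q0 r0) lerDl mulr_ge0 ?(ltW p0) //.
by rewrite subr_ge0 ln_le_sub1 // divr_gt0 // mulr_gt0.
Qed.

Definition kl_slope (R : realType) (p q x y : R) : R :=
  x * (1 - ln (q / p)) - y * p / q.

(** [1 + e * k] is the relative change of the likelihood ratio. At [e = 0] this is
    half of the second derivative of [kl_term] in direction [(x, y)]. *)
Definition kl_remainder (R : realType) (p q x y e : R) : R :=
  let k := (y / q - x / p) / (1 + e * x / p) in
  (p + e * x) * (k ^+ 2 / 2 - e * k ^+ 3 / 3).

(** Along the segment in direction [(x, y)] the term exceeds its tangent by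
    [(p + e * x) * (w - 1 - ln w)], where the likelihood ratio is multiplied by w;
    the cubic bound on the logarithm makes this a rational function. *)
Lemma kl_term_ge_quadratic (R : realType) (p q x y e : R) : 0 < p -> 0 < q ->
  0 < p + e * x -> 0 < q + e * y ->
  kl_term p q + e * kl_slope p q x y + e ^+ 2 * kl_remainder p q x y e
  <= kl_term (p + e * x) (q + e * y).
Proof.
move=> p0 q0 pe qe; rewrite /kl_remainder /kl_slope.
set k := ((y / q - x / p) / (1 + e * x / p)).
have r0 : 0 < q / p by rewrite divr_gt0.
rewrite (kl_term_tangent pe qe r0).
have ke : (q + e * y) / ((p + e * x) * (q / p)) = 1 + e * k.
  by rewrite /k; field; rewrite !gt_eqF // mulrC.
have k1 : -1 < e * k.
  have : 0 < 1 + e * k by rewrite -ke divr_gt0 // mulr_gt0.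
  by lra.
have := ln1D_le_cubic k1; rewrite ke => h.
have {h} h : (p + e * x) * (e ^+ 2 * (k ^+ 2 / 2 - e * k ^+ 3 / 3)) <=
  (p + e * x) * (1 + e * k - 1 - ln (1 + e * k)).
  by rewrite ler_pM2l //; lra.
rewrite [X in X + _ + _ <= _]/kl_term.
have -> : ln (p / q) = - ln (q / p) by rewrite -lnV ?posrE // invf_div.
have e1 : p + e * x - (q + e * y) / (q / p) = e * (x - y * p / q).
  by field; rewrite !gt_eqF.
by lra.
Qed.

(** * Curvature of the cost under an exchange between two cells *)

Definition merging_loss (R : realType) (p q p' q' : R) : R :=
  kl_term p q + kl_term p' q' - kl_term (p + p') (q + q').

(** The bound on the inverse is a sum of a multiple of [p^-1] and one of [p'^-1],
    the form that the second derivatives have. It is [ln_chord_gap] for the best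
    value of [lam]. *)
Lemma merging_loss_inv_le (R : realType) (p q p' q' z E : R) :
  0 < p -> 0 < q -> 0 < p' -> 0 < q' -> 0 < z ->
  1 + z = (q' * p) / (p' * q) -> E = z - ln (1 + z) ->
  0 < E /\ 0 < merging_loss p q p' q' /\
  (merging_loss p q p' q')^-1 <= (p' * E)^-1 + z ^+ 2 / (2 * E ^+ 2 * p).
Proof.
move=> p0 q0 p0' q0' z0 zE EE.
have E0 : 0 < E.
  have := @ln_lt_sub1 R (1 + z); rewrite EE addrAC subrr add0r subr_gt0.
  by apply; rewrite ?gt_eqF //; lra.
split=> //.
pose w := p' / (p + p').
have pp0 : 0 < p + p' by rewrite addr_gt0.
have w0 : 0 < w by rewrite divr_gt0.
have w1 : 1 - w = p / (p + p') by rewrite /w; field; rewrite gt_eqF.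
have w10 : 0 < 1 - w by rewrite w1 divr_gt0.
have JE : merging_loss p q p' q' = (p + p') * (ln (1 + w * z) - w * ln (1 + z)).
  have -> : 1 + w * z = ((q + q') / (p + p')) * (p / q).
    have -> : z = (q' * p) / (p' * q) - 1 by rewrite -zE; ring.
    by rewrite /w; field; rewrite !gt_eqF.
  have qq0 : 0 < q + q' by rewrite addr_gt0.
  have m1 := mulr_gt0 p0' q0; have m2 := mulr_gt0 q0' p0.
  have d1 := divr_gt0 qq0 pp0; have d2 := divr_gt0 p0 q0.
  rewrite zE /merging_loss /kl_term (lnM d1 d2) (ln_div m2 m1) (lnM q0' p0).
  rewrite (lnM p0' q0) (ln_div p0 q0) (ln_div p0' q0') !(ln_div qq0 pp0).
  rewrite (ln_div pp0 qq0) /w.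
  by field; rewrite gt_eqF.
pose D := (1 - w) * E + w * z ^+ 2 / 2.
have D0 : 0 < D.
  by rewrite /D; apply: addr_gt0; rewrite ?divr_gt0 // mulr_gt0 // exprn_gt0.
have lb : w * (1 - w) * (E ^+ 2 / D) <= ln (1 + w * z) - w * ln (1 + z).
  have := @ln_chord_gap R w z E (E / D) (ltW w0) _ (ltW z0) EE.
  rewrite -/D; have -> : 2 * (E / D) * E - (E / D) ^+ 2 * D = E ^+ 2 / D.
    by field; rewrite gt_eqF.
  by apply; rewrite -subr_ge0 ltW.
have Jlb : (p + p') * (w * (1 - w) * (E ^+ 2 / D)) <= merging_loss p q p' q'.
  by rewrite JE ler_pM2l.
have lb0 : 0 < (p + p') * (w * (1 - w) * (E ^+ 2 / D)).
  by rewrite !mulr_gt0 ?invr_gt0 ?exprn_gt0.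
have J0 := lt_le_trans lb0 Jlb.
split=> //.
have -> : (p' * E)^-1 + z ^+ 2 / (2 * E ^+ 2 * p)
   = ((p + p') * (w * (1 - w) * (E ^+ 2 / D)))^-1.
  rewrite /D w1 /w; field; rewrite !gt_eqF //.
  by rewrite !addr_gt0 ?mulr_gt0 ?exprn_gt0.
by rewrite lef_pV2.
Qed.

(** The left-hand side minus the right-hand side increases with A, so that the
    largest admissible value [s ^+ 2 / (s + 2)] decides. *)
Lemma curvature_coef (R : realType) (s A h : R) : 0 < s -> 0 < A ->
  0 <= h <= 1 -> A * (s + 2) <= s ^+ 2 ->
  A * (1 + h / s) ^+ 2 + 2 * (1 - h) <= s ^+ 2 / A.
Proof.
move=> s0 A0 /andP[h0 h1] As.
rewrite ler_pdivlMr //.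
have s2 : 0 < s ^+ 2 by rewrite exprn_gt0.
rewrite -(ler_pM2r s2).
have -> : (A * (1 + h / s) ^+ 2 + 2 * (1 - h)) * A * s ^+ 2 =
   A ^+ 2 * (s + h) ^+ 2 + 2 * (1 - h) * A * s ^+ 2 by field; rewrite gt_eqF.
have s20 : 0 < s + 2 by lra.
rewrite -(ler_pM2r (exprn_gt0 2 s20)).
set B := A * (s + 2) in As.
have -> : (A ^+ 2 * (s + h) ^+ 2 + 2 * (1 - h) * A * s ^+ 2) * (s + 2) ^+ 2
  = B ^+ 2 * (s + h) ^+ 2 + 2 * (1 - h) * (s + 2) * s ^+ 2 * B by rewrite /B; ring.
have B0 : 0 < B by rewrite mulr_gt0.
have B2 : B ^+ 2 <= s ^+ 2 * s ^+ 2 by rewrite expr2 ler_pM // ltW.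
apply: (@le_trans _ _ (s ^+ 2 * s ^+ 2 * (s + h) ^+ 2
    + 2 * (1 - h) * (s + 2) * s ^+ 2 * s ^+ 2)).
  apply: lerD; first by rewrite ler_wpM2r // sqr_ge0.
  by rewrite ler_wpM2l // !mulr_ge0 ?subr_ge0 //; lra.
rewrite -subr_ge0.
have -> : s ^+ 2 * s ^+ 2 * (s + 2) ^+ 2 - (s ^+ 2 * s ^+ 2 * (s + h) ^+ 2
    + 2 * (1 - h) * (s + 2) * s ^+ 2 * s ^+ 2)
  = s ^+ 2 * s ^+ 2 * (2 * s + h * (4 - h)) by ring.
rewrite mulr_ge0 ?(mulr_ge0 (ltW s2) (ltW s2)) //.
by rewrite addr_ge0 ?mulr_ge0 //; lra.
Qed.

Lemma ln1D_ge (R : realType) (t : R) : 0 <= t -> t / (1 + t) <= ln (1 + t).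
Proof.
move=> t0; have t1 : 0 < 1 + t by lra.
have : 0 < (1 + t)^-1 by rewrite invr_gt0.
move=> /ln_le_sub1; rewrite lnV ?posrE // => h.
have -> : t / (1 + t) = 1 - (1 + t)^-1 by field; rewrite gt_eqF.
by lra.
Qed.

(** The part of [curvature_sum] that is proportional to [p^-1]; the part in [p'^-1]
    is its mirror image under the exchange of s and t. The substitution is
    [h = s * ln (1 + z) / E], for which [1 - h] is proportional to B and
    [1 + h / s = z / E]. *)
Lemma curvature_side (R : realType) (s t z E A B : R) : 0 < s -> 0 < t ->
  z = s + t + s * t -> E = z - ln (1 + z) -> 0 < E ->
  A = s + t / (1 + t) - ln (1 + z) -> B = t + s / (1 + s) - ln (1 + z) ->
  0 < A -> 0 < B ->
  A * z ^+ 2 / E ^+ 2 + 2 * (1 + s) * B / E <= s ^+ 2 / A.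
Proof.
move=> s0 t0 zE EE E0 AE BE A0 B0.
have s1 : 0 < 1 + s by lra.
have t1 : 0 < 1 + t by lra.
have LE : ln (1 + z) = ln (1 + s) + ln (1 + t).
  by rewrite zE -lnM ?posrE //; congr (ln _); ring.
have l1 := @ln1D_ge_pade R s (ltW s0).
have l2 := @ln1D_ge R t (ltW t0).
have As : A * (s + 2) <= s ^+ 2.
  have s2 : 0 < s + 2 by lra.
  rewrite -ler_pdivlMr // AE LE.
  have -> : s ^+ 2 / (s + 2) = s - 2 * s / (2 + s) by field; rewrite !gt_eqF //; lra.
  by lra.
pose L := ln (1 + z).
have L0 : 0 <= L by apply: ln_ge0; rewrite zE; nra.
have hB : 1 - s * L / E = (1 + s) * B / E.
  rewrite (_ : (1 + s) * B = E - s * L); first by field; rewrite gt_eqF.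
  by rewrite BE EE /L zE; field; rewrite gt_eqF.
have hz : 1 + s * L / E / s = z / E.
  by rewrite (_ : z = E + L); [field; rewrite !gt_eqF|rewrite EE /L; ring].
have := @curvature_coef R s A (s * L / E) s0 A0 _ As.
rewrite hB hz expr_div_n !mulrA; apply.
apply/andP; split; first by rewrite divr_ge0 ?mulr_ge0 // ltW.
by rewrite -subr_ge0 hB divr_ge0 ?mulr_ge0 // ltW.
Qed.

(** Here [s] and [t] locate the exchanged likelihood ratio d between those of the
    cells, [q / p = d / (1 + s)] and [q' / p' = d * (1 + t)], and [A], [d * B] are
    the absolute slopes of the two divergences. *)
Lemma curvature_sum (R : realType) (s t z E A B p p' : R) : 0 < s -> 0 < t ->
  0 < p -> 0 < p' ->
  z = s + t + s * t -> E = z - ln (1 + z) -> 0 < E ->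
  A = s + t / (1 + t) - ln (1 + z) -> B = t + s / (1 + s) - ln (1 + z) ->
  0 < A -> 0 < B ->
  2 * (A * ((p' * E)^-1 + z ^+ 2 / (2 * E ^+ 2 * p))
     + B * ((1 + s) / (p * E) + z ^+ 2 / (2 * E ^+ 2 * ((1 + t) * p'))))
  < (s ^+ 2 / p + (t / (1 + t)) ^+ 2 / p') / A
    + (s ^+ 2 / ((1 + s) * p) + t ^+ 2 / ((1 + t) * p')) / B.
Proof.
move=> s0 t0 p0 p0' zE EE E0 AE BE A0 B0.
have s1 : 0 < 1 + s by lra.
have t1 : 0 < 1 + t by lra.
have h1 := curvature_side s0 t0 zE EE E0 AE BE A0 B0.
have zE' : z = t + s + t * s by rewrite zE; ring.
have h2 := curvature_side t0 s0 zE' EE E0 BE AE B0 A0.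
have -> : 2 * (A * ((p' * E)^-1 + z ^+ 2 / (2 * E ^+ 2 * p))
     + B * ((1 + s) / (p * E) + z ^+ 2 / (2 * E ^+ 2 * ((1 + t) * p'))))
  = (A * z ^+ 2 / E ^+ 2 + 2 * (1 + s) * B / E) / p
   + (B * z ^+ 2 / E ^+ 2 + 2 * (1 + t) * A / E) / ((1 + t) * p').
  by field; rewrite !gt_eqF.
have -> : (s ^+ 2 / p + (t / (1 + t)) ^+ 2 / p') / A
    + (s ^+ 2 / ((1 + s) * p) + t ^+ 2 / ((1 + t) * p')) / B
  = s ^+ 2 / A / p + t ^+ 2 / B / ((1 + t) * p')
   + (s ^+ 2 / ((1 + s) * p * B) + (t / (1 + t)) ^+ 2 / (p' * A)).
  by field; rewrite !gt_eqF.
apply: ltr_pwDr.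
  apply: addr_gt0; apply: divr_gt0; by rewrite ?(mulr_gt0, invr_gt0).
by rewrite lerD // ler_wpM2r // invr_ge0 ltW // mulr_gt0.
Qed.

Lemma kl_slopeE (R : realType) (p q p' q' x y : R) :
  0 < p -> 0 < q -> 0 < p' -> 0 < q' ->
  kl_slope p q x y - kl_slope p' q' x y
  = x * ln ((q' / p') / (q / p)) - y * (p / q - p' / q').
Proof.
move=> p0 q0 p0' q0'; rewrite /kl_slope.
rewrite (@ln_div _ (q' / p') (q / p)) ?posrE ?divr_gt0 //.
by ring.
Qed.

(** The conclusion is minus half of the second derivative of [c0 / a + c1 / b] as mass
    moves in direction [(1, d)] from the second cell to the first one. Convexity of
    [a] and [b] gives the positive terms; they win because a stationary exchange
    requires d to lie between the two likelihood ratios. *)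
Lemma curvature_lt0 (R : realType) (c0 c1 a b p q p' q' d a1 b1 al be : R) :
  0 < c0 -> 0 < c1 -> 0 < a -> 0 < b ->
  0 < p -> 0 < q -> 0 < p' -> 0 < q' -> 0 < d -> q / p < q' / p' ->
  merging_loss p q p' q' <= a -> merging_loss q p q' p' <= b ->
  a1 = kl_slope p q 1 d - kl_slope p' q' 1 d ->
  b1 = kl_slope q p d 1 - kl_slope q' p' d 1 ->
  al = kl_remainder p q 1 d 0 + kl_remainder p' q' (-1) (- d) 0 ->
  be = kl_remainder q p d 1 0 + kl_remainder q' p' (- d) (-1) 0 ->
  c0 * a1 / a ^+ 2 + c1 * b1 / b ^+ 2 = 0 ->
  0 < c0 * (al / a ^+ 2 - a1 ^+ 2 / a ^+ 3) + c1 * (be / b ^+ 2 - b1 ^+ 2 / b ^+ 3).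
Proof.
move=> c00 c10 a0 b0 p0 q0 p0' q0' d0 rr Ja Jb a1E b1E alE beE stat.
pose y := (q' / p') / (q / p).
have r0 : 0 < q / p by rewrite divr_gt0.
have r0' : 0 < q' / p' by rewrite divr_gt0.
have y1 : 1 < y by rewrite /y ltr_pdivlMr // mul1r.
pose L := ln y.
have L0 : 0 < L by exact: ln_gt0.
have a1E' : a1 = L - d * (p / q - p' / q') by rewrite a1E kl_slopeE // mul1r.
have b1E' : b1 = (q' / p' - q / p) - d * L.
  rewrite b1E kl_slopeE //.
  have -> : p' / q' / (p / q) = y^-1 by rewrite /y; field; rewrite !gt_eqF.
  by rewrite lnV ?posrE; [rewrite /L; ring|lra].
have ia : 0 < c0 / a ^+ 2 by rewrite divr_gt0 ?exprn_gt0.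
have ib : 0 < c1 / b ^+ 2 by rewrite divr_gt0 ?exprn_gt0.
have stat' : c0 / a ^+ 2 * a1 = - (c1 / b ^+ 2 * b1) by move: stat; lra.
have alE' : al = ((1 - d * p / q) ^+ 2 / p + (1 - d * p' / q') ^+ 2 / p') / 2.
  by rewrite alE /kl_remainder !mul0r !addr0 !subr0 !divr1; field; rewrite !gt_eqF.
have beE' : be = ((d - q / p) ^+ 2 / q + (d - q' / p') ^+ 2 / q') / 2.
  by rewrite beE /kl_remainder !mul0r !addr0 !subr0 !divr1; field; rewrite !gt_eqF.
have [a1_lt0|a1_gt0|a1_0] := ltgtP a1 0; last first.
- have b1_0 : b1 = 0.
    move: stat'; rewrite a1_0 mulr0 => /esym /eqP.
    by rewrite oppr_eq0 mulf_eq0 gt_eqF //= => /eqP.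
  have be0 : 0 <= be.
    by rewrite beE' divr_ge0 // addr_ge0 // divr_ge0 ?sqr_ge0 // ltW.
  have al0 : 0 < al.
    have sq (x c : R) : 0 < c -> x != 0 -> 0 < x ^+ 2 / c.
      by move=> c0' x0; rewrite divr_gt0 // lt_neqAle sqr_ge0 eq_sym sqrf_eq0 x0.
    have sq' (x c : R) : 0 < c -> 0 <= x ^+ 2 / c.
      by move=> c0'; rewrite divr_ge0 ?sqr_ge0 ?ltW.
    rewrite alE' divr_gt0 //.
    have ratio (x u : R) : 0 < u -> 1 - d * x / u = 0 -> u = d * x.
      move=> u0 /eqP; rewrite subr_eq0 eq_sym => /eqP /(congr1 ( *%R^~ u)).
      by rewrite mul1r divfK ?gt_eqF.
    have [h|h] := eqVneq (1 - d * p / q) 0; last by rewrite ltr_pwDl ?sq ?sq'.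
    have h' : 1 - d * p' / q' != 0; last by rewrite ltr_wpDl ?sq ?sq'.
    apply: contraTneq rr => h'; rewrite -leNgt.
    have -> : q / p = d by apply: (mulIf (lt0r_neq0 p0)); rewrite divfK ?gt_eqF //; exact: ratio q0 h.
    have -> // : q' / p' = d.
    by apply: (mulIf (lt0r_neq0 p0')); rewrite divfK ?gt_eqF //; exact: ratio q0' h'.
  rewrite a1_0 b1_0 expr0n /= !mul0r !subr0.
  apply: ltr_pwDl; first by rewrite mulr_gt0 ?divr_gt0 ?exprn_gt0.
  by apply: mulr_ge0 (ltW c10) (divr_ge0 be0 _); rewrite exprn_ge0 // ltW.
(* Slopes of these signs contradict [sqr_ln_le]. *)
- exfalso.
  have b1_lt0 : b1 < 0.
    have : 0 < - (c1 / b ^+ 2 * b1) by rewrite -stat' mulr_gt0.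
    by rewrite oppr_gt0 pmulr_rlt0.
  have := sqr_ln_le (ltW y1).
  rewrite -/L leNgt => /negP; apply.
  have yu : 0 < y by lra.
  have h1 : (y - 1) * (q / p) < d * L.
    by rewrite (_ : (y - 1) * (q / p) = q' / p' - q / p); [lra|rewrite /y; field; rewrite !gt_eqF].
  have h2 : d * (y - 1) < L * (y * (q / p)).
    have -> : d * (y - 1) = d * (p / q - p' / q') * (y * (q / p)).
      by rewrite /y; field; rewrite !gt_eqF.
    rewrite (ltr_pM2r (mulr_gt0 yu r0)) -subr_gt0 -a1E'; exact: a1_gt0.
  have y10 : 0 < y - 1 by lra.
  rewrite -(ltr_pM2r (mulr_gt0 d0 r0)).
  have -> : (y - 1) ^+ 2 * (d * (q / p)) = (d * (y - 1)) * ((y - 1) * (q / p)) by ring.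
  have -> : y * L ^+ 2 * (d * (q / p)) = (L * (y * (q / p))) * (d * L) by ring.
  exact: (ltr_pM (ltW (mulr_gt0 d0 y10)) (ltW (mulr_gt0 y10 r0)) h2 h1).
have b1_gt0 : 0 < b1.
  have : c0 / a ^+ 2 * a1 < 0 by rewrite pmulr_rlt0.
  by rewrite stat' oppr_lt0 pmulr_rgt0.
have Ly : 1 - y^-1 <= L.
  have : 0 < y^-1 by rewrite invr_gt0; lra.
  by move/ln_le_sub1; rewrite lnV ?posrE; [rewrite /L; lra|lra].
(* The signs of the slopes place d strictly between the two likelihood ratios. *)
pose s := d / (q / p) - 1; pose t := (q' / p') / d - 1.
have yL : (y - 1) / y <= L by rewrite mulrBl mul1r divff // gt_eqF //; lra.
have yr : q' / p' - q / p = (y - 1) * (q / p) by rewrite /y; field; rewrite !gt_eqF.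
have yr' : q' / p' = y * (q / p) by rewrite /y; field; rewrite !gt_eqF.
have y10 : 0 < y - 1 by lra.
have y0 : 0 < y by lra.
have s0 : 0 < s.
  rewrite /s subr_gt0 ltr_pdivlMr // mul1r.
  have : L < d * (p / q - p' / q') by lra.
  have -> : p / q - p' / q' = (y - 1) / y / (q / p) by rewrite /y; field; rewrite !gt_eqF.
  move=> /(le_lt_trans yL); rewrite mulrCA -[X in X < _]mulr1 ltr_pM2l ?divr_gt0 //.
  by rewrite ltr_pdivlMr // mul1r.
have t0 : 0 < t.
  rewrite /t subr_gt0 ltr_pdivlMr // mul1r yr'.
  have : d * L < (y - 1) * (q / p) by rewrite -yr; lra.
  have : d * ((y - 1) / y) <= d * L by rewrite ler_pM2l.
  move=> /le_lt_trans h /h; rewrite mulrCA.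
  by rewrite (ltr_pM2l y10) ltr_pdivrMr // [y * _]mulrC.
have s1E : 1 + s = d / (q / p) by rewrite /s; ring.
have qE : q = p * d / (1 + s) by rewrite s1E; field; rewrite !gt_eqF.
have qE' : q' = p' * d * (1 + t) by rewrite /t; field; rewrite !gt_eqF.
pose z := s + t + s * t.
have yE : y = 1 + z by rewrite /y /z /s /t; field; rewrite !gt_eqF.
pose E := z - ln (1 + z).
have z0 : 0 < z by exact: addr_gt0 (addr_gt0 s0 t0) (mulr_gt0 s0 t0).
have zE1 : 1 + z = (q' * p) / (p' * q) by rewrite -yE /y; field; rewrite !gt_eqF.
have zE2 : 1 + z = (p * q') / (q * p') by rewrite zE1; field; rewrite !gt_eqF.
have [E0 [J0 Jle]] := merging_loss_inv_le p0 q0 p0' q0' z0 zE1 erefl.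
have [_ [J0' Jle']] := merging_loss_inv_le q0' p0' q0 p0 z0 zE2 erefl.
have L_z : L = ln (1 + z) by rewrite /L yE.
pose A := - a1; pose B := b1 / d.
have A0 : 0 < A by rewrite oppr_gt0.
have B0 : 0 < B by rewrite divr_gt0.
have s1 : 0 < 1 + s by lra.
have t1 : 0 < 1 + t by lra.
have AE : A = s + t / (1 + t) - ln (1 + z).
  by rewrite /A a1E' -L_z qE qE'; field; rewrite !gt_eqF.
have BE : B = t + s / (1 + s) - ln (1 + z).
  by rewrite /B b1E' -L_z qE qE'; field; rewrite !gt_eqF.
have key := curvature_sum s0 t0 p0 p0' erefl erefl E0 AE BE A0 B0.
rewrite -/z -/E in key.
pose sg := c0 * A / a ^+ 2.
have sg0 : 0 < sg by rewrite divr_gt0 ?mulr_gt0 ?exprn_gt0.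
have c0E : c0 = sg * a ^+ 2 / A by rewrite /sg; field; rewrite !gt_eqF.
have c1E : c1 = sg * b ^+ 2 / (d * B).
  have -> : sg = c1 * (d * B) / b ^+ 2.
    have -> : d * B = b1 by rewrite /B; field; rewrite gt_eqF.
    by move: stat; rewrite /sg /A; lra.
  by field; rewrite !gt_eqF.
have b1B : b1 = d * B by rewrite /B; field; rewrite gt_eqF.
have a1A : a1 = - A by rewrite /A opprK.
have -> : c0 * (al / a ^+ 2 - a1 ^+ 2 / a ^+ 3) + c1 * (be / b ^+ 2 - b1 ^+ 2 / b ^+ 3)
  = sg * (al / A + be / (d * B) - (A * a^-1 + d * B * b^-1)).
  by rewrite {1}c0E {1}c1E b1B a1A; field; rewrite !gt_eqF.
rewrite mulr_gt0 // subr_gt0.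
have ale : a^-1 <= (p' * E)^-1 + z ^+ 2 / (2 * E ^+ 2 * p).
  by apply: le_trans Jle; rewrite lef_pV2.
have ble : b^-1 <= (q * E)^-1 + z ^+ 2 / (2 * E ^+ 2 * q').
  have JC : merging_loss q' p' q p = merging_loss q p q' p'.
    by rewrite /merging_loss [q' + q]addrC [p' + p]addrC; ring.
  by rewrite JC in J0' Jle'; apply: le_trans Jle'; rewrite lef_pV2.
apply: (@le_lt_trans _ _ (A * ((p' * E)^-1 + z ^+ 2 / (2 * E ^+ 2 * p))
   + d * B * ((q * E)^-1 + z ^+ 2 / (2 * E ^+ 2 * q')))).
  by rewrite lerD // ler_wpM2l // ltW // mulr_gt0.
have -> : A * ((p' * E)^-1 + z ^+ 2 / (2 * E ^+ 2 * p))
   + d * B * ((q * E)^-1 + z ^+ 2 / (2 * E ^+ 2 * q')) =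
   2^-1 * (2 * (A * ((p' * E)^-1 + z ^+ 2 / (2 * E ^+ 2 * p))
     + B * ((1 + s) / (p * E) + z ^+ 2 / (2 * E ^+ 2 * ((1 + t) * p'))))).
  by rewrite qE qE'; field; rewrite !gt_eqF.
have -> : al / A + be / (d * B) = 2^-1 * ((s ^+ 2 / p + (t / (1 + t)) ^+ 2 / p') / A
    + (s ^+ 2 / ((1 + s) * p) + t ^+ 2 / ((1 + t) * p')) / B).
  by rewrite alE' beE' qE qE'; field; rewrite !gt_eqF.
by rewrite ltr_pM2l.
Qed.

(** * Descent along an exchange *)

Lemma cvg_perturbed (R : realType) (f f1 : R) (ph : R -> R) : {for 0, continuous ph} ->
  (f + e * f1 + e ^+ 2 * ph e) @[e --> (0 : R)] --> f.
Proof.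
move=> cph; rewrite -[X in _ --> X]addr0 -[X in _ --> X + _]addr0.
rewrite -[X in _ --> _ + X + _](mul0r f1) -[X in _ --> _ + _ + X](mul0r (ph 0)).
apply: cvgD; last first.
  apply: cvgM cph; rewrite -[X in _ --> X](@expr0n R 2).
  exact: exprn_continuous.
by apply: cvgD; [exact: cvg_cst|apply: cvgMl; exact: cvg_id].
Qed.

(** The cost decreases in both denominators, so quadratic lower bounds for them
    suffice: along these the slope of the cost vanishes and its curvature is
    negative. *)
Lemma descent (R : realType) (c0 c1 a b a1 b1 : R) (al be : R -> R) :
  0 < c0 -> 0 < c1 -> 0 < a -> 0 < b ->
  {for 0, continuous al} -> {for 0, continuous be} ->
  c0 * a1 / a ^+ 2 + c1 * b1 / b ^+ 2 = 0 ->
  0 < c0 * (al 0 / a ^+ 2 - a1 ^+ 2 / a ^+ 3)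
      + c1 * (be 0 / b ^+ 2 - b1 ^+ 2 / b ^+ 3) ->
  exists2 dl, 0 < dl & forall e, e != 0 -> `|e| < dl ->
    [/\ 0 < a + e * a1 + e ^+ 2 * al e, 0 < b + e * b1 + e ^+ 2 * be e &
     c0 / (a + e * a1 + e ^+ 2 * al e) + c1 / (b + e * b1 + e ^+ 2 * be e)
     < c0 / a + c1 / b].
Proof.
move=> c00 c10 a0 b0 cal cbe stat curv.
pose val c f f1 (ph : R -> R) e : R :=
  c * (ph e / (f * (f + e * f1 + e ^+ 2 * ph e))
       - f1 * (f1 + e * ph e) / (f ^+ 2 * (f + e * f1 + e ^+ 2 * ph e))).
have cval c f f1 (ph : R -> R) : 0 < f -> {for 0, continuous ph} ->
    val c f f1 ph e @[e --> (0 : R)] --> c * (ph 0 / f ^+ 2 - f1 ^+ 2 / f ^+ 3).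
  move=> f0 cph.
  have -> : c * (ph 0 / f ^+ 2 - f1 ^+ 2 / f ^+ 3)
    = c * (ph 0 / (f * f) - f1 * (f1 + 0 * ph 0) / (f ^+ 2 * f)).
    by field; rewrite gt_eqF.
  have cd := @cvg_perturbed R f f1 ph cph.
  apply: cvgMr; apply: cvgB.
    by apply: cvgM cph _; apply: cvgV; [rewrite gt_eqF // mulr_gt0|exact: cvgMr].
  apply: cvgM.
    by apply: cvgMr; apply: cvgD; [exact: cvg_cst|apply: cvgM cph; exact: cvg_id].
  by apply: cvgV; [rewrite gt_eqF // mulr_gt0 // exprn_gt0|exact: cvgMr].
have cv : (val c0 a a1 al e + val c1 b b1 be e) @[e --> (0 : R)] -->
    c0 * (al 0 / a ^+ 2 - a1 ^+ 2 / a ^+ 3) + c1 * (be 0 / b ^+ 2 - b1 ^+ 2 / b ^+ 3).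
  by apply: cvgD; exact: cval.
have /nbhs_ballP[dl /= dl0 H] : \forall e \near (0 : R), (val c0 a a1 al e + val c1 b b1 be e > 0)
   /\ (a + e * a1 + e ^+ 2 * al e > 0) /\ (b + e * b1 + e ^+ 2 * be e > 0).
  near=> e; split; first by near: e; exact: (cvgr_gt _ cv).
  split; near: e; first exact: (cvgr_gt _ (@cvg_perturbed R a a1 al cal)).
  exact: (cvgr_gt _ (@cvg_perturbed R b b1 be cbe)).
exists dl => // e e0 ed.
have [g0 [at0 bt0]] : _ /\ _ /\ _ := H e ltac:(by rewrite /ball /= sub0r normrN).
split=> //; rewrite -subr_gt0.
have -> : c0 / a + c1 / b - (c0 / (a + e * a1 + e ^+ 2 * al e)
   + c1 / (b + e * b1 + e ^+ 2 * be e))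
  = e * (c0 * a1 / a ^+ 2 + c1 * b1 / b ^+ 2)
    + e ^+ 2 * (val c0 a a1 al e + val c1 b b1 be e).
  by rewrite /val; field; rewrite !gt_eqF.
by rewrite stat mulr0 add0r mulr_gt0 // lt_neqAle sqr_ge0 eq_sym sqrf_eq0 e0.
Unshelve. all: by end_near. Qed.

Lemma descent_first_order (R : realType) (c0 c1 a b a1 b1 : R) :
  0 < c0 -> 0 < c1 -> 0 < a -> 0 < b ->
  0 < c0 * a1 / a ^+ 2 + c1 * b1 / b ^+ 2 ->
  exists2 dl, 0 < dl & forall e, 0 < e -> e < dl ->
    [/\ 0 < a + e * a1, 0 < b + e * b1 &
     c0 / (a + e * a1) + c1 / (b + e * b1) < c0 / a + c1 / b].
Proof.
move=> c00 c10 a0 b0 slope.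
have cden f f1 : (f + e * f1) @[e --> (0 : R)] --> (f : R).
  rewrite -[X in _ --> X]addr0 -[X in _ --> _ + X](mul0r f1).
  by apply: cvgD; [exact: cvg_cst|apply: cvgMl; exact: cvg_id].
have cval c f f1 : 0 < f ->
    c * f1 / (f * (f + e * f1)) @[e --> (0 : R)] --> c * f1 / f ^+ 2.
  move=> f0; apply: cvgMr; rewrite expr2.
  by apply: cvgV; [rewrite gt_eqF // mulr_gt0|by apply: cvgMr; exact: cden].
have cv : (c0 * a1 / (a * (a + e * a1)) + c1 * b1 / (b * (b + e * b1)))
    @[e --> (0 : R)] --> c0 * a1 / a ^+ 2 + c1 * b1 / b ^+ 2.
  by apply: cvgD; exact: cval.
have /nbhs_ballP[dl /= dl0 H] : \forall e \near (0 : R),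
   (c0 * a1 / (a * (a + e * a1)) + c1 * b1 / (b * (b + e * b1)) > 0)
   /\ (a + e * a1 > 0) /\ (b + e * b1 > 0).
  near=> e; split; first by near: e; exact: (cvgr_gt _ cv).
  split; near: e; first exact: (cvgr_gt _ (cden a a1)).
  exact: (cvgr_gt _ (cden b b1)).
exists dl => // e e0 ed.
have [g0 [at0 bt0]] : _ /\ _ /\ _ :=
  H e ltac:(by rewrite /ball /= sub0r normrN gtr0_norm).
split=> //; rewrite -subr_gt0.
have -> : c0 / a + c1 / b - (c0 / (a + e * a1) + c1 / (b + e * b1))
  = e * (c0 * a1 / (a * (a + e * a1)) + c1 * b1 / (b * (b + e * b1))).
  by field; rewrite !gt_eqF.
by rewrite mulr_gt0.
Unshelve. all: by end_near. Qed.

Lemma continuous_kl_remainder (R : realType) (p q x y : R) :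
  {for 0, continuous (kl_remainder p q x y)}.
Proof.
rewrite /continuous_at /kl_remainder.
have ck : (y / q - x / p) / (1 + e * x / p) @[e --> (0 : R)]
    --> (y / q - x / p) / (1 + 0 * x / p).
  apply: cvgMr; apply: cvgV; first by rewrite !mul0r addr0 oner_neq0.
  apply: cvgD; first exact: cvg_cst.
  by apply: cvgMl; apply: cvgMl; exact: cvg_id.
apply: cvgM.
  by apply: cvgD; [exact: cvg_cst|apply: cvgMl; exact: cvg_id].
apply: cvgB; first by apply: cvgMl; exact: (cvgM ck ck).
apply: cvgMl; apply: cvgM; first exact: cvg_id.
exact: (cvgM ck (cvgM ck ck)).
Qed.

(** The divergence after the fraction e of the mass [(x, y)] has moved from the
    second cell to the first one; [a0] gathers what does not change. *)
Definition moved_div (R : realType) (a0 p q p' q' x y e : R) : R :=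
  a0 + kl_term (p + e * x) (q + e * y) + kl_term (p' - e * x) (q' - e * y).

Lemma moved_div_ge (R : realType) (a0 p q p' q' x y e : R) :
  0 < p -> 0 < q -> 0 < p' -> 0 < q' ->
  0 < p + e * x -> 0 < q + e * y -> 0 < p' - e * x -> 0 < q' - e * y ->
  moved_div a0 p q p' q' x y 0
  + e * (kl_slope p q x y - kl_slope p' q' x y)
  + e ^+ 2 * (kl_remainder p q x y e + kl_remainder p' q' (- x) (- y) e)
  <= moved_div a0 p q p' q' x y e.
Proof.
move=> p0 q0 p0' q0' pe qe pe' qe'.
rewrite /moved_div !mul0r !addr0 !subr0.
have h1 := kl_term_ge_quadratic p0 q0 pe qe.
have := @kl_term_ge_quadratic R p' q' (- x) (- y) e p0' q0'.
rewrite !mulrN => /(_ pe' qe') h2.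
have sN : kl_slope p' q' (- x) (- y) = - kl_slope p' q' x y by rewrite /kl_slope; ring.
by rewrite sN in h2; lra.
Qed.

Lemma moved_div_ge1 (R : realType) (a0 p q p' q' x y e : R) :
  0 < p -> 0 < q -> 0 < p' -> 0 < q' ->
  0 < p + e * x -> 0 < q + e * y -> 0 < p' - e * x -> 0 < q' - e * y ->
  moved_div a0 p q p' q' x y 0
  + e * (kl_slope p q x y - kl_slope p' q' x y)
  <= moved_div a0 p q p' q' x y e.
Proof.
move=> p0 q0 p0' q0' pe qe pe' qe'.
rewrite /moved_div !mul0r !addr0 !subr0.
have h1 := kl_term_ge_tangent pe qe (divr_gt0 q0 p0).
have h2 := kl_term_ge_tangent pe' qe' (divr_gt0 q0' p0').
have e1 u v : 0 < u -> 0 < v -> kl_term u v = u * (1 - ln (v / u)) - v / (v / u) :> R.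
  move=> u0 v0; rewrite /kl_term -[u / v]invf_div lnV ?posrE ?divr_gt0 //.
  by field; rewrite !gt_eqF.
rewrite (e1 _ _ p0 q0) (e1 _ _ p0' q0').
apply: le_trans (lerD (lerD (lexx _) h1) h2).
rewrite le_eqVlt; apply/orP; left; apply/eqP; rewrite /kl_slope.
by field; rewrite !gt_eqF.
Qed.

(** By convexity the divergences after a move are at least their tangents, so a
    positive slope would make a small move profitable. *)
Lemma slope_le0_of_optimal (R : realType) (c0 c1 a0 b0 p q p' q' x y : R) :
  0 < c0 -> 0 < c1 -> 0 < p -> 0 < q -> 0 < p' -> 0 < q' ->
  0 <= x -> 0 <= y -> x <= p' -> y <= q' ->
  let a := moved_div a0 p q p' q' x y in
  let b := moved_div b0 q p q' p' y x in
  0 < a 0 -> 0 < b 0 ->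
  (forall e, 0 < e -> e < 1 -> 0 < a e -> 0 < b e ->
     c0 / a 0 + c1 / b 0 <= c0 / a e + c1 / b e) ->
  c0 * (kl_slope p q x y - kl_slope p' q' x y) / a 0 ^+ 2
  + c1 * (kl_slope q p y x - kl_slope q' p' y x) / b 0 ^+ 2 <= 0.
Proof.
move=> c00 c10 p0 q0 p0' q0' x0 y0 xp yq a b a00 b00 opt.
rewrite leNgt; apply/negP => /(descent_first_order c00 c10 a00 b00)[dl dl0 H].
pose e := Num.min dl 1 / 2.
have m0 : 0 < Num.min dl 1 by rewrite lt_min dl0 ltr01.
have mdl : Num.min dl 1 <= dl by rewrite ge_min lexx.
have m1 : Num.min dl 1 <= 1 by rewrite ge_min lexx orbT.
have e0 : 0 < e by rewrite /e; lra.
have e1 : e < 1 by rewrite /e; lra.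
have edl : e < dl by rewrite /e; lra.
have pe : 0 < p + e * x by rewrite ltr_wpDr // mulr_ge0 // ltW.
have qe : 0 < q + e * y by rewrite ltr_wpDr // mulr_ge0 // ltW.
have small u v : 0 <= u -> u <= v -> 0 < v -> 0 < v - e * u.
  move=> u0 uv v0; rewrite subr_gt0; have [->|un0] := eqVneq u 0; first by rewrite mulr0.
  by apply: lt_le_trans uv; rewrite gtr_pMl // lt_neqAle eq_sym un0.
have pe' := small _ _ x0 xp p0'; have qe' := small _ _ y0 yq q0'.
have [at0 bt0 lt] := H e e0 edl.
have ae := moved_div_ge1 a0 p0 q0 p0' q0' pe qe pe' qe'.
have be := moved_div_ge1 b0 q0 p0 q0' p0' qe pe qe' pe'.
have := opt e e0 e1 (lt_le_trans at0 ae) (lt_le_trans bt0 be).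
rewrite leNgt => /negP; apply; apply: le_lt_trans lt.
by apply: lerD; rewrite ler_pM2l // lef_pV2 ?posrE // (lt_le_trans _ ae, lt_le_trans _ be).
Qed.

(** A stationary exchange is a strict local maximum of the cost: the nonnegativity
    hypotheses say that the divergences stay nonnegative when the two cells are
    merged, which is what [curvature_lt0] needs. *)
Lemma stationary_move_improves (R : realType) (c0 c1 a0 b0 p q p' q' d : R) :
  0 < c0 -> 0 < c1 -> 0 < p -> 0 < q -> 0 < p' -> 0 < q' -> 0 < d ->
  q / p < q' / p' ->
  0 <= a0 + kl_term (p + p') (q + q') -> 0 <= b0 + kl_term (q + q') (p + p') ->
  let a := moved_div a0 p q p' q' 1 d in
  let b := moved_div b0 q p q' p' d 1 in
  0 < a 0 -> 0 < b 0 ->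
  c0 * (kl_slope p q 1 d - kl_slope p' q' 1 d) / a 0 ^+ 2
  + c1 * (kl_slope q p d 1 - kl_slope q' p' d 1) / b 0 ^+ 2 = 0 ->
  exists2 dl, 0 < dl & forall e, e != 0 -> `|e| < dl ->
    [/\ 0 < a e, 0 < b e & c0 / a e + c1 / b e < c0 / a 0 + c1 / b 0].
Proof.
move=> c00 c10 p0 q0 p0' q0' d0 rr Ja Jb a b a00 b00 stat.
pose al e := kl_remainder p q 1 d e + kl_remainder p' q' (-1) (- d) e.
pose be e := kl_remainder q p d 1 e + kl_remainder q' p' (- d) (-1) e.
have Ja' : merging_loss p q p' q' <= a 0.
  by rewrite /a /moved_div /merging_loss !mul0r !addr0 !subr0; lra.
have Jb' : merging_loss q p q' p' <= b 0.
  by rewrite /b /moved_div /merging_loss !mul0r !addr0 !subr0; lra.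
have curv := curvature_lt0 c00 c10 a00 b00 p0 q0 p0' q0' d0 rr Ja' Jb'
  erefl erefl (erefl (al 0)) (erefl (be 0)) stat.
have cal : {for 0, continuous al}.
  by apply: cvgD; exact: continuous_kl_remainder.
have cbe : {for 0, continuous be}.
  by apply: cvgD; exact: continuous_kl_remainder.
have [dl dl0 H] := descent c00 c10 a00 b00 cal cbe stat curv.
pose m := Num.min (Num.min p p') (Num.min (q / d) (q' / d)).
have m0 : 0 < m by rewrite !lt_min p0 p0' !divr_gt0.
exists (Num.min dl m); first by rewrite lt_min dl0.
move=> e e0; rewrite !lt_min => /andP[edl /andP[/andP[ep ep'] /andP[eq eq']]].
have [at0 bt0 lt] := H e e0 edl.
move: ep ep' eq eq'; rewrite !ltr_pdivlMr //.
have := ler_norm e; have := ler_norm (- e); rewrite normrN => n1 n2 ep ep' eq eq'.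
have pe : 0 < p + e * 1 by lra.
have pe' : 0 < p' - e * 1 by lra.
have n1d : - e * d <= `|e| * d by rewrite ler_pM2r.
have n2d : e * d <= `|e| * d by rewrite ler_pM2r.
have qe : 0 < q + e * d by lra.
have qe' : 0 < q' - e * d by lra.
have ae := moved_div_ge a0 p0 q0 p0' q0' pe qe pe' qe'.
have be' := moved_div_ge b0 q0 p0 q0' p0' qe pe qe' pe'.
have A0 := lt_le_trans at0 ae; have B0 := lt_le_trans bt0 be'.
split=> //; apply: le_lt_trans lt.
by apply: lerD; rewrite ler_pM2l // lef_pV2.
Qed.

(** * Probabilities and likelihood ratios *)

Section Measures.
Context {d : measure_display} {X : measurableType d} {R : realType}.
Implicit Types (P : probability X R) (A B : set X).

Definition pr P A : R := fine (P A).

Lemma prE P A : measurable A -> P A = (pr P A)%:E.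
Proof. by move=> mA; rewrite /pr fineK // fin_num_measure. Qed.

Lemma pr_ge0 P A : 0 <= pr P A.
Proof. exact: fine_ge0. Qed.

Lemma prT P : pr P setT = 1.
Proof. by rewrite /pr probability_setT. Qed.

Lemma pr0 P : pr P set0 = 0.
Proof. by rewrite /pr measure0. Qed.

Lemma prU P A B : measurable A -> measurable B -> A `&` B = set0 ->
  pr P (A `|` B) = pr P A + pr P B.
Proof.
move=> mA mB AB; apply: EFin_inj; rewrite EFinD -!prE //; last exact: measurableU.
exact: measureU.
Qed.

Lemma pr_le P A B : measurable A -> measurable B -> A `<=` B -> pr P A <= pr P B.
Proof.
move=> mA mB AB; rewrite -lee_fin -!prE //.
by apply: le_measure => //; rewrite inE.
Qed.

Lemma pr_le1 P A : measurable A -> pr P A <= 1.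
Proof. by move=> mA; rewrite -(prT P); exact: pr_le. Qed.

Lemma prC P A : measurable A -> pr P (~` A) = 1 - pr P A.
Proof.
move=> mA; have := @prU P _ _ mA (measurableC mA) (setICr A).
by rewrite setUv prT => ->; ring.
Qed.

Lemma pr_ac P P' A : P `<< P' -> measurable A -> pr P' A = 0 -> pr P A = 0.
Proof.
move=> ac mA A0; rewrite /pr; have := ac A.
have : P'.-null_set A by apply/(measure0_null_setP P' mA); exact: etrans (prE P' mA) (congr1 EFin A0).
by move=> h /(_ h A mA (@subset_refl _ _)); rewrite /pr => ->.
Qed.

Lemma pr_cvg0 P (D : nat -> set X) : (forall k, measurable (D k)) ->
  (forall k l, (k <= l)%N -> D l `<=` D k) -> pr P (\bigcap_k D k) = 0 ->
  forall e : R, 0 < e -> exists k, pr P (D k) < e.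
Proof.
move=> mD ndD D0 e e0.
have mcap : measurable (\bigcap_k D k) by exact: bigcapT_measurable.
have h : P (D k) @[k --> \oo] --> P (\bigcap_k D k).
  apply: nonincreasing_cvg_mu => //.
    by apply: le_lt_trans (ltry 1); exact: probability_le1.
  by move=> k l kl; apply/subsetPset; exact: ndD.
have {h} : pr P (D k) @[k --> \oo] --> 0.
  by rewrite -D0; apply: fine_cvg; rewrite fineK // fin_num_measure.
move=> /cvgr_lt /(_ e e0) [k _ /(_ k) /=] h.
by exists k; apply: h.
Qed.

Lemma density_ratio_le (mu : {measure set X -> \bar R}) P P' (f f' : X -> R) (a b : R) A :
  is_density mu P f -> is_density mu P' f' -> 0 <= a -> 0 <= b -> measurable A ->
  (forall x, A x -> a * f x <= b * f' x) -> a * pr P A <= b * pr P' A.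
Proof.
move=> [mf f0 Pf] [mf' f0' Pf'] a0 b0 mA le.
rewrite -lee_fin !EFinM -!prE // Pf // Pf' //.
have mfA : measurable_fun A (EFin \o f).
  by apply/measurable_EFinP; apply: measurable_funS mf.
have mfA' : measurable_fun A (EFin \o f').
  by apply/measurable_EFinP; apply: measurable_funS mf'.
rewrite -!ge0_integralZl_EFin //; try by move=> x _; rewrite lee_fin.
apply: ge0_le_integral => //.
- by move=> x _; rewrite mule_ge0 ?lee_fin.
- exact: measurable_funeM.
- exact: measurable_funeM.
Qed.

Lemma measurable_ratio_le (f f' : X -> R) (a b : R) :
  measurable_fun setT f -> measurable_fun setT f' ->
  measurable [set x | a * f x <= b * f' x].
Proof.
move=> mf mf'.
have m : measurable_fun setT (fun x => a * f x <= b * f' x).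
  by apply: measurable_fun_ler; apply: measurable_funM => //; exact: measurable_cst.
have := m measurableT [set true] I; rewrite setTI.
by congr (measurable _); apply/seteqP; split=> x.
Qed.

Lemma measurable_ratio_lt (f f' : X -> R) (a b : R) :
  measurable_fun setT f -> measurable_fun setT f' ->
  measurable [set x | a * f x < b * f' x].
Proof.
move=> mf mf'; rewrite (_ : [set _ | _] = ~` [set x | b * f' x <= a * f x]).
  exact/measurableC/measurable_ratio_le.
by apply/seteqP; split=> x /=; rewrite ltNge => /negP.
Qed.

Lemma pr_density0 (mu : {measure set X -> \bar R}) P (f : X -> R) :
  is_density mu P f -> pr P [set x | f x <= 0] = 0.
Proof.
move=> hf; have [mf f0 Pf] := hf.
have mA : measurable [set x | f x <= 0].
  have := @measurable_ratio_le f (cst 0) 1 1 mf (measurable_cst _).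
  by under eq_set do rewrite !mul1r.
apply/eqP; rewrite eq_le pr_ge0 andbT.
have := @density_ratio_le mu P P f f 1 0 _ hf hf ler01 (lexx _) mA.
by rewrite mul1r mul0r; apply=> x /=; rewrite mul1r mul0r.
Qed.

End Measures.

(** * Allocations of the two laws to labels *)

Section Allocations.
Context {d : measure_display} {X : measurableType d} {R : realType} {K : nat}.
Implicit Types (P : probability X R) (f : X -> R) (n : 'I_K -> set X -> R).
Implicit Types (A B : set X) (u v w : 'I_K).

(** [n u A] stands for the probability of A together with label u under a randomised
    rule. Only finite additivity is required, a condition that pointwise limits
    preserve; domination by [P] makes up for the rest. *)
Definition allots P n : Prop :=
  [/\ forall u A, measurable A -> 0 <= n u A,
      forall u A B, measurable A -> measurable B -> A `&` B = set0 ->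
        n u (A `|` B) = n u A + n u B &
      forall A, measurable A -> \sum_u n u A = pr P A].

(** The two masses of a label inherit the likelihood ratio of the two laws; the
    inequality between integrals replaces the equality of densities because it is
    closed under pointwise limits. *)
Definition ratio_respecting f f' n n' : Prop :=
  forall u (a b : R) A, 0 <= a -> 0 <= b -> measurable A ->
    (forall x, A x -> a * f x <= b * f' x) -> a * n u A <= b * n' u A.

Definition allocation (P0 P1 : probability X R) (f0 f1 : X -> R) n0 n1 : Prop :=
  [/\ allots P0 n0, allots P1 n1, ratio_respecting f0 f1 n0 n1 &
      ratio_respecting f1 f0 n1 n0].

Lemma allocation_sym P0 P1 f0 f1 n0 n1 :
  allocation P0 P1 f0 f1 n0 n1 -> allocation P1 P0 f1 f0 n1 n0.
Proof. by case. Qed.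

Definition rule_mass P (phi : X -> 'I_K) u A : R := pr P (A `&` phi @^-1` [set u]).

Lemma rule_massT P phi u : rule_mass P phi u setT = induced_pmf P phi u.
Proof. by rewrite /rule_mass setTI. Qed.

Lemma allots_rule P phi : quantizer phi -> allots P (rule_mass P phi).
Proof.
move=> q; split=> [u A mA|u A B mA mB AB|A mA].
- exact: pr_ge0.
- rewrite /rule_mass setIUl prU //; try exact: measurableI.
  by rewrite setIACA setIid AB set0I.
- have mF u : measurable (A `&` phi @^-1` [set u]) by exact: measurableI.
  apply: EFin_inj; rewrite -sumEFin -prE //.
  under eq_bigr => u _ do rewrite /rule_mass -prE //.
  rewrite -(@measure_bigsetU_ord _ _ _ P K predT) //.
    congr (P _); rewrite -bigcup_seq; apply/seteqP; split=> [x [u _ []] //|x Ax].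
    by exists (phi x) => //=; rewrite mem_index_enum.
  by move=> u v _ _ [x [[_ /= <-] [_ /= <-]]].
Qed.

Lemma allocation_rule (mu : {measure set X -> \bar R}) P0 P1 f0 f1 phi :
  is_density mu P0 f0 -> is_density mu P1 f1 -> quantizer phi ->
  allocation P0 P1 f0 f1 (rule_mass P0 phi) (rule_mass P1 phi).
Proof.
move=> hf0 hf1 q; split; [exact: allots_rule|exact: allots_rule| |].
- move=> u a b A a0 b0 mA le.
  by apply: (density_ratio_le hf0 hf1) => // [|x [/le]//]; exact: measurableI.
- move=> u a b A a0 b0 mA le.
  by apply: (density_ratio_le hf1 hf0) => // [|x [/le]//]; exact: measurableI.
Qed.

Section OneLaw.
Context {P : probability X R} {n : 'I_K -> set X -> R} (hn : allots P n).

Lemma allots_ge0 u A : measurable A -> 0 <= n u A.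
Proof. by case: hn => + _ _; exact. Qed.

Lemma allotsU u A B : measurable A -> measurable B -> A `&` B = set0 ->
  n u (A `|` B) = n u A + n u B.
Proof. by case: hn => _ + _; exact. Qed.

Lemma allots_sum A : measurable A -> \sum_u n u A = pr P A.
Proof. by case: hn => _ _; exact. Qed.

Lemma allots0 u : n u set0 = 0.
Proof.
have := @allotsU u set0 set0 measurable0 measurable0 (set0I _).
by rewrite setU0; lra.
Qed.

Lemma allots_split u A B : measurable A -> measurable B ->
  n u A = n u (A `&` B) + n u (A `\` B).
Proof.
move=> mA mB; rewrite -allotsU; first by rewrite setUIDK.
- exact: measurableI.
- exact: measurableD.
- by rewrite setDE setIACA setICr setI0.
Qed.

Lemma allots_le u A B : measurable A -> measurable B -> A `<=` B -> n u A <= n u B.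
Proof.
move=> mA mB AB; rewrite (allots_split u mB mA) setIidr // lerDl.
by apply: allots_ge0; exact: measurableD.
Qed.

Lemma allots_leU u A B : measurable A -> measurable B ->
  n u (A `|` B) <= n u A + n u B.
Proof.
move=> mA mB; have mU : measurable (A `|` B) by exact: measurableU.
rewrite (allots_split u mU mA) lerD //; apply: allots_le => //.
- exact: measurableI.
- exact: measurableD.
- by move=> x [[//|//]].
Qed.

Lemma allots_le_pr u A : measurable A -> n u A <= pr P A.
Proof.
move=> mA; rewrite -(allots_sum mA) (bigD1 u) //= lerDl.
by apply: sumr_ge0 => v _; exact: allots_ge0.
Qed.

Lemma allots_null_le u A B : measurable A -> measurable B -> A `<=` B ->
  n u B = 0 -> n u A = 0.
Proof.
move=> mA mB AB B0; apply/eqP; rewrite eq_le allots_ge0 // andbT -B0.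
exact: allots_le.
Qed.

Lemma allots_null_setU u A B : measurable A -> measurable B ->
  n u A = 0 -> n u B = 0 -> n u (A `|` B) = 0.
Proof.
move=> mA mB A0 B0; apply/eqP; rewrite eq_le allots_ge0 ?andbT; last exact: measurableU.
by rewrite (le_trans (allots_leU u mA mB)) // A0 B0 addr0.
Qed.

(** Countable unions are reached although [n u] is only finitely additive: what
    lies beyond a finite union has small [P]-mass. *)
Lemma allots_null_bigcup u (A : nat -> set X) : (forall k, measurable (A k)) ->
  (forall k, n u (A k) = 0) -> n u (\bigcup_k A k) = 0.
Proof.
move=> mA A0; pose U := \bigcup_k A k; pose B m := \big[setU/set0]_(k < m) A k.
have mU : measurable U by exact: bigcup_measurable.
have mB m : measurable (B m) by apply: bigsetU_measurable.
have B0 m : n u (B m) = 0.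
  elim: m => [|m IH]; first by rewrite /B big_ord0 allots0.
  by rewrite /B big_ord_recr /=; apply: allots_null_setU => //; exact: mB.
have mD m : measurable (U `\` B m) by exact: measurableD.
have ndD m k : (m <= k)%N -> U `\` B k `<=` U `\` B m.
  by move=> mk; apply: setDS; apply: subset_bigsetU.
have D0 : pr P (\bigcap_m (U `\` B m)) = 0.
  rewrite (_ : \bigcap_m _ = set0) ?pr0 //; apply/seteqP; split=> // x Dx.
  have [[k _ Akx] _] := Dx 0%N I; have [_] := Dx k.+1 I; apply.
  by rewrite /B big_ord_recr /=; right.
apply/eqP; rewrite eq_le allots_ge0 // andbT leNgt; apply/negP => U0.
have [m] := pr_cvg0 mD ndD D0 U0.
apply/negP; rewrite -leNgt.
rewrite -[X in n u X](@setUIDK _ U (B m)).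
apply: le_trans (allots_leU u _ (mD m)) _; first exact: measurableI.
rewrite (@allots_null_le u _ (B m)) ?add0r //; first exact: allots_le_pr.
exact: measurableI.
Qed.

End OneLaw.

Section TwoLaws.
Context {mu : {measure set X -> \bar R}} {P0 P1 : probability X R} {f0 f1 : X -> R}.
Hypotheses (hf0 : is_density mu P0 f0) (hf1 : is_density mu P1 f1).
Hypothesis ac : P1 `<< P0.
Context {n0 n1 : 'I_K -> set X -> R} (hn : allocation P0 P1 f0 f1 n0 n1).

(** On [f1 <= k * f0] the second mass is at most [k] times the first one; these
    sets exhaust the space up to the null set where [f0] vanishes. *)
Lemma allocation_ac u B : measurable B -> n0 u B = 0 -> n1 u B = 0.
Proof.
move=> mB B0.
have [mf0 f00 _] := hf0; have [mf1 f10 _] := hf1.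
have [h0 h1 _ hr] := hn.
pose A k := B `&` [set x | 1 * f1 x <= k%:R * f0 x].
have mA k : measurable (A k) by apply: measurableI => //; exact: measurable_ratio_le.
pose Z := [set x | f0 x <= 0].
have mZ : measurable Z.
  rewrite (_ : Z = [set x | 1 * f0 x <= 1 * cst 0 x]).
    exact: measurable_ratio_le.
  by apply/seteqP; split=> x; rewrite /Z /= !mul1r.
have A0 k : n1 u (A k) = 0.
  apply/eqP; rewrite eq_le (allots_ge0 h1) // andbT -[n1 u _]mul1r.
  apply: (@le_trans _ _ (k%:R * n0 u (A k))); first by apply: hr => // x [].
  by rewrite (allots_null_le h0 (mA k) mB) ?mulr0 // => x [].
have mU : measurable (\bigcup_k A k) by exact: bigcup_measurable.
apply: (allots_null_le h1 (B := Z `|` \bigcup_k A k)) => //.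
- exact: measurableU.
- move=> x Bx; have [x0|x0] := leP (f0 x) 0; [by left|right].
  exists (Num.bound (f1 x / f0 x)) => //; split=> //=.
  rewrite mul1r -ler_pdivrMr // ltW //.
  by apply: archi_boundP; rewrite divr_ge0 // ltW.
- apply: (allots_null_setU h1) => //; last exact: (allots_null_bigcup h1).
  apply/eqP; rewrite eq_le (allots_ge0 h1) // andbT.
  apply: le_trans (allots_le_pr h1 u mZ) _.
  by rewrite (pr_ac ac mZ) // (pr_density0 hf0).
Qed.

(** On [f1 <= c' * f0] with [c' < c] the second mass is at most [c'] times the first,
    against the hypothesis; the sets with [c' < c] exhaust [f1 < c * f0]. *)
Lemma allocation_null_lt u (c : R) : 0 < c ->
  (forall B, measurable B -> c * n0 u B <= n1 u B) ->
  n0 u [set x | 1 * f1 x < c * f0 x] = 0.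
Proof.
move=> c0 H.
have [mf0 f00 _] := hf0; have [mf1 f10 _] := hf1.
have [h0 h1 _ hr] := hn.
pose ck (k : nat) := c * (1 - k.+1%:R^-1).
pose L := [set x | 1 * f1 x < c * f0 x].
have mL : measurable L by exact: measurable_ratio_lt.
pose A k := L `&` [set x | 1 * f1 x <= ck k * f0 x].
have mA k : measurable (A k) by apply: measurableI => //; exact: measurable_ratio_le.
have k0 k : 0 < k.+1%:R^-1 :> R by rewrite invr_gt0.
have k1 k : k.+1%:R^-1 <= 1 :> R by rewrite invf_le1 // ler1n.
have A0 k : n0 u (A k) = 0.
  have le1 : 1 * n1 u (A k) <= ck k * n0 u (A k).
    by apply: hr => // [|x []//]; rewrite mulr_ge0 ?subr_ge0 // ltW.
  have := H _ (mA k); rewrite -[n1 u _]mul1r => /le_trans /(_ le1).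
  rewrite /ck => le2.
  have : c * k.+1%:R^-1 * n0 u (A k) <= 0.
    set i := k.+1%:R^-1 in le2 *.
    by rewrite (_ : c * i * _ = c * n0 u (A k) - c * (1 - i) * n0 u (A k)) ?subr_le0 //; ring.
  by rewrite pmulr_rle0 ?mulr_gt0 // => le0; apply/eqP; rewrite eq_le le0 (allots_ge0 h0).
rewrite -/L (_ : L = \bigcup_k A k); first exact: (allots_null_bigcup h0).
apply/seteqP; split=> [x Lx|x [k _ []] //].
have dx : 0 < c * f0 x - f1 x by move: Lx; rewrite /L /= mul1r subr_gt0.
have fx : 0 <= c * f0 x by rewrite mulr_ge0 // ltW.
pose k := Num.bound (c * f0 x / (c * f0 x - f1 x)).
have hk : c * f0 x / (c * f0 x - f1 x) <= k.+1%:R.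
  apply: (@le_trans _ _ k%:R); last by rewrite ler_nat.
  by apply/ltW/archi_boundP/divr_ge0 => //; exact: ltW.
exists k => //; split=> //=.
have hi : c * f0 x / k.+1%:R <= c * f0 x - f1 x.
  by rewrite ler_pdivrMr // [X in _ <= X]mulrC -ler_pdivrMr.
rewrite /ck mul1r (_ : c * _ * _ = c * f0 x - c * f0 x / k.+1%:R); last by ring.
by move: hi; set i := _ / k.+1%:R; lra.
Qed.

End TwoLaws.
End Allocations.

(** * Divergence between label masses, and transfers of mass *)

Definition compatible (R : realType) (K : nat) (p q : 'I_K -> R) : Prop :=
  [/\ forall u, 0 <= p u, forall u, 0 <= q u, forall u, p u = 0 <-> q u = 0 &
      \sum_u p u = \sum_u q u].

Section FiniteDivergence.
Context {R : realType} {K : nat}.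
Implicit Types (p q : 'I_K -> R) (u v : 'I_K).

Lemma kl_divE p q : kl_div p q = \sum_u kl_term (p u) (q u).
Proof. by []. Qed.

Lemma compatible_sym p q : compatible p q -> compatible q p.
Proof. by case=> p0 q0 pq s; split=> // u; split=> /pq. Qed.

Lemma compatible_gt0 p q u : compatible p q -> p u != 0 -> 0 < p u /\ 0 < q u.
Proof.
move=> [p0 q0 pq _] pu; have qu : q u != 0.
  by apply: contra pu => /eqP /pq /eqP.
by rewrite !lt_neqAle p0 q0 !andbT eq_sym pu eq_sym qu.
Qed.

Lemma kl_term_ge p q u : compatible p q -> p u - q u <= kl_term (p u) (q u) ?= iff (p u == q u).
Proof.
move=> c; have [pu|pu] := eqVneq (p u) 0.
  have qu : q u = 0 by case: c => _ _ /(_ u)[h _] _; exact: h.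
  by rewrite /kl_term pu qu subrr mul0r eqxx; split; rewrite ?lexx ?eqxx.
have [pu0 qu0] := compatible_gt0 c pu.
have e := kl_term_tangent pu0 qu0 (@ltr01 R).
rewrite ln1 subr0 mulr1 divr1 in e.
rewrite e; have [->|npq] := eqVneq (p u) (q u).
  by rewrite divff ?gt_eqF // ln1 !subrr mulr0 addr0; split; rewrite ?lexx ?eqxx.
have r1 : q u / p u != 1.
  apply: contra npq => /eqP h.
  by rewrite -[q u](divfK (lt0r_neq0 pu0)) h mul1r.
have h : 0 < p u * (q u / p u - 1 - ln (q u / p u)).
  by rewrite mulr_gt0 // subr_gt0 ln_lt_sub1 // divr_gt0.
by split; [rewrite lerDl ltW|rewrite lt_eqF // ltrDl].
Qed.

Lemma kl_div_ge0 p q : compatible p q -> 0 <= kl_div p q.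
Proof.
move=> c; have [_ _ _ s] := c.
have -> : 0 = \sum_u (p u - q u) by rewrite sumrB s subrr.
by apply: ler_sum => u _; exact: (kl_term_ge u c).1.
Qed.

Lemma kl_div_eq0 p q : compatible p q -> kl_div p q = 0 -> p = q.
Proof.
move=> c e; have [_ _ _ s] := c.
apply/funext => u; apply/eqP.
have h w : 0 <= kl_term (p w) (q w) - (p w - q w).
  by rewrite subr_ge0; exact: (kl_term_ge w c).1.
have : \sum_w (kl_term (p w) (q w) - (p w - q w)) = 0.
  by rewrite !sumrB s subrr -kl_divE e subrr.
move=> /eqP; rewrite psumr_eq0 // => /allP /(_ u (mem_index_enum _)) /=.
by rewrite subr_eq0 eq_sym (kl_term_ge u c).2.
Qed.

Definition kl_rest p q u v : R :=
  \sum_(w | (w != u) && (w != v)) kl_term (p w) (q w).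

Lemma kl_div_split p q u v : u != v ->
  kl_div p q = kl_rest p q u v + kl_term (p u) (q u) + kl_term (p v) (q v).
Proof.
move=> uv; rewrite kl_divE (bigD1 u) //= (bigD1 v) /=; last by rewrite eq_sym.
by rewrite /kl_rest; ring.
Qed.

Definition shift_mass p (u v : 'I_K) (x : R) : 'I_K -> R :=
  fun w => p w + (if w == u then x else 0) - (if w == v then x else 0).

Lemma kl_div_shift p q u v x y : u != v ->
  kl_div (shift_mass p u v x) (shift_mass q u v y)
  = kl_rest p q u v + kl_term (p u + x) (q u + y) + kl_term (p v - x) (q v - y).
Proof.
move=> uv; rewrite (kl_div_split _ _ uv) /shift_mass !eqxx (negbTE uv).
rewrite eq_sym (negbTE uv) !subr0 !addr0; congr (_ + _ + _).
by apply: eq_bigr => w /andP[/negbTE -> /negbTE ->]; rewrite !addr0 !subr0.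
Qed.

(** This is the divergence after merging the labels u and v. *)
Lemma merged_kl_ge0 p q u v : u != v -> compatible p q ->
  0 <= kl_rest p q u v + kl_term (p u + p v) (q u + q v).
Proof.
move=> uv c; have [p0 q0 pq s] := c.
have := kl_div_shift p q (p v) (q v) uv.
rewrite !subrr [X in _ = _ + X]/kl_term mul0r addr0 => <-.
have val r w : shift_mass r u v (r v) w = if w == v then 0 else
    if w == u then r u + r v else r w.
  rewrite /shift_mass; have [->|_] := eqVneq w v.
    by rewrite eq_sym (negbTE uv) addr0 subrr.
  by have [->|_] := eqVneq w u; rewrite ?addr0 subr0.
have ge0 r w : (forall z, 0 <= r z) -> 0 <= shift_mass r u v (r v) w.
  by move=> r0; rewrite val; case: ifP => // _; case: ifP => // _; rewrite addr_ge0.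
have tot r : \sum_w shift_mass r u v (r v) w = \sum_w r w.
  rewrite /shift_mass sumrB big_split /= -!big_mkcond /=.
  by rewrite !big_pred1_eq addrK.
apply: kl_div_ge0; split=> [w|w|w|]; [exact: ge0|exact: ge0| |by rewrite !tot].
rewrite !val; case: ifP => // _; case: ifP => // _.
split=> /eqP; rewrite paddr_eq0 // => /andP[/eqP /pq -> /eqP /pq ->]; exact: addr0.
Qed.

End FiniteDivergence.

Section Moves.
Context {d : measure_display} {X : measurableType d} {R : realType} {K : nat}.
Implicit Types (n : 'I_K -> set X -> R) (A B : set X) (u v w : 'I_K).

Definition total n u : R := n u setT.

(** The fraction e of what label v holds in B receives the label u. *)
Definition move_mass n u v B (e : R) : 'I_K -> set X -> R :=
  fun w A => shift_mass (n^~ A) u v (e * n v (A `&` B)) w.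

Lemma total_move n u v B e :
  total (move_mass n u v B e) = shift_mass (total n) u v (e * n v B).
Proof. by apply/funext => w; rewrite /total /move_mass setTI. Qed.

Lemma allots_move P n u v B e : allots P n -> u != v -> measurable B ->
  0 <= e <= 1 -> allots P (move_mass n u v B e).
Proof.
move=> h uv mB /andP[e0 e1]; split=> [w A mA|w A A' mA mA' AA|A mA].
- have mAB : measurable (A `&` B) by exact: measurableI.
  have i0 := allots_ge0 h v mAB.
  rewrite /move_mass /shift_mass; have [->|_] := eqVneq w v.
    rewrite eq_sym (negbTE uv) addr0 subr_ge0 (allots_split h v mA mB).
    apply: (@le_trans _ _ (n v (A `&` B))); first by rewrite ler_piMl.
    by rewrite lerDl (allots_ge0 h) //; exact: measurableD.
  rewrite subr0; apply: addr_ge0; first exact: (allots_ge0 h).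
  by case: ifP => // _; rewrite mulr_ge0.
- rewrite /move_mass /shift_mass setIUl !(allotsU h) //; try exact: measurableI.
    by do 2 case: ifP => _; ring.
  by rewrite setIACA AA set0I.
- rewrite /move_mass /shift_mass sumrB big_split /= -!big_mkcond /=.
  by rewrite !big_pred1_eq addrK (allots_sum h).
Qed.

Lemma ratio_respecting_move P P' f f' n n' u v B e :
  allots P n -> allots P' n' -> ratio_respecting f f' n n' -> u != v -> measurable B ->
  0 <= e <= 1 -> ratio_respecting f f' (move_mass n u v B e) (move_mass n' u v B e).
Proof.
move=> h h' r uv mB /andP[e0 e1] w a b A a0 b0 mA le.
have mAB : measurable (A `&` B) by exact: measurableI.
have mAD : measurable (A `\` B) by exact: measurableD.
have rI : a * n v (A `&` B) <= b * n' v (A `&` B) by apply: r => // x [/le].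
rewrite /move_mass /shift_mass; have [->|_] := eqVneq w v.
  have rD : a * n v (A `\` B) <= b * n' v (A `\` B) by apply: r => // x [/le].
  rewrite eq_sym (negbTE uv) !addr0 (allots_split h v mA mB) (allots_split h' v mA mB).
  have : (1 - e) * (a * n v (A `&` B)) <= (1 - e) * (b * n' v (A `&` B)).
    by rewrite ler_wpM2l // subr_ge0.
  by move: rD; lra.
rewrite !subr0; have rA : a * n w A <= b * n' w A by exact: r.
case: ifP => // _; last by rewrite !addr0.
have : e * (a * n v (A `&` B)) <= e * (b * n' v (A `&` B)) by rewrite ler_wpM2l.
by move: rA; lra.
Qed.

Lemma allocation_move P0 P1 f0 f1 n0 n1 u v B e :
  allocation P0 P1 f0 f1 n0 n1 -> u != v -> measurable B -> 0 <= e <= 1 ->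
  allocation P0 P1 f0 f1 (move_mass n0 u v B e) (move_mass n1 u v B e).
Proof.
move=> [h0 h1 r r'] uv mB e01; split.
- exact: allots_move.
- exact: allots_move.
- exact: ratio_respecting_move h0 h1 r uv mB e01.
- exact: ratio_respecting_move h1 h0 r' uv mB e01.
Qed.

End Moves.

(** * First- and second-order conditions at an optimum *)

Section Optimality.
Context {d : measure_display} {X : measurableType d} {R : realType} {K : nat}.
Context {mu : {measure set X -> \bar R}} {P0 P1 : probability X R} {f0 f1 : X -> R}.
Hypotheses (hf0 : is_density mu P0 f0) (hf1 : is_density mu P1 f1).
Hypotheses (ac01 : P0 `<< P1) (ac10 : P1 `<< P0).
Implicit Types (n m : 'I_K -> set X -> R) (u v w : 'I_K) (A B : set X).
Local Notation alloc := (allocation P0 P1 f0 f1).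

Lemma allocation_compatible n0 n1 : alloc n0 n1 -> compatible (total n0) (total n1).
Proof.
move=> h; have [h0 h1 _ _] := h; split.
- by move=> u; apply: (allots_ge0 h0).
- by move=> u; apply: (allots_ge0 h1).
- move=> u; split.
    exact: (allocation_ac hf0 hf1 ac10 h).
  exact: (allocation_ac hf1 hf0 ac01 (allocation_sym h)).
- by rewrite (allots_sum h0) // (allots_sum h1) // !prT.
Qed.

Lemma allocation_null_gt n0 n1 u (c : R) : alloc n0 n1 -> 0 < c ->
  (forall B, measurable B -> n1 u B <= c * n0 u B) ->
  n0 u [set x | c * f0 x < 1 * f1 x] = 0.
Proof.
move=> h c0 H.
have [mf0 _ _] := hf0; have [mf1 _ _] := hf1.
rewrite (_ : [set _ | _] = [set x | 1 * f0 x < c^-1 * f1 x]); last first.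
  by apply/funext => x /=; rewrite !mul1r ltr_pdivlMl.
apply: (allocation_ac hf1 hf0 ac01 (allocation_sym h)).
  exact: measurable_ratio_lt.
apply: (allocation_null_lt hf1 hf0 (allocation_sym h)); first by rewrite invr_gt0.
by move=> B mB; rewrite ler_pdivrMl // H.
Qed.

Lemma allocation_eq_ratio n0 n1 u (c : R) A : alloc n0 n1 -> 0 <= c ->
  measurable A -> (forall x, A x -> f1 x = c * f0 x) -> n1 u A = c * n0 u A.
Proof.
move=> [_ _ r r'] c0 mA e; apply/eqP; rewrite eq_le.
rewrite -{1}[n1 u A]mul1r r' //=; last by move=> x /e ->; rewrite mul1r.
by rewrite -[n1 u A]mul1r r // => x /e ->; rewrite mul1r.
Qed.

Context {c0 c1 d0 d1 : R}.
Hypotheses (c0_gt0 : 0 < c0) (c1_gt0 : 0 < c1) (d0_ge0 : 0 <= d0) (d1_ge0 : 0 <= d1).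

(** [d0] and [d1] stand for the divergences of the other quantizers of the design. *)
Definition den0 n0 n1 : R := d0 + kl_div (total n0) (total n1).
Definition den1 n0 n1 : R := d1 + kl_div (total n1) (total n0).
Definition cost n0 n1 : R := c0 / den0 n0 n1 + c1 / den1 n0 n1.

Definition optimal n0 n1 : Prop :=
  [/\ alloc n0 n1, 0 < den0 n0 n1, 0 < den1 n0 n1 &
   forall m0 m1, alloc m0 m1 -> 0 < den0 m0 m1 -> 0 < den1 m0 m1 ->
     cost n0 n1 <= cost m0 m1].

Lemma den0_move n0 n1 u v B e : u != v ->
  den0 (move_mass n0 u v B e) (move_mass n1 u v B e) =
  moved_div (d0 + kl_rest (total n0) (total n1) u v) (total n0 u) (total n1 u)
    (total n0 v) (total n1 v) (n0 v B) (n1 v B) e.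
Proof.
by move=> uv; rewrite /den0 /moved_div !total_move kl_div_shift // !addrA.
Qed.

Lemma den1_move n0 n1 u v B e : u != v ->
  den1 (move_mass n0 u v B e) (move_mass n1 u v B e) =
  moved_div (d1 + kl_rest (total n1) (total n0) u v) (total n1 u) (total n0 u)
    (total n1 v) (total n0 v) (n1 v B) (n0 v B) e.
Proof.
by move=> uv; rewrite /den1 /moved_div !total_move kl_div_shift // !addrA.
Qed.

Lemma moved_div0 a0 p q p' q' x y :
  moved_div a0 p q p' q' x y 0 = a0 + kl_term p q + kl_term p' q' :> R.
Proof. by rewrite /moved_div !mul0r !addr0 !subr0. Qed.

Lemma den0_split n0 n1 u v x y : u != v -> den0 n0 n1 =
  moved_div (d0 + kl_rest (total n0) (total n1) u v) (total n0 u) (total n1 u)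
    (total n0 v) (total n1 v) x y 0.
Proof. by move=> uv; rewrite moved_div0 /den0 (kl_div_split _ _ uv) !addrA. Qed.

Lemma den1_split n0 n1 u v x y : u != v -> den1 n0 n1 =
  moved_div (d1 + kl_rest (total n1) (total n0) u v) (total n1 u) (total n0 u)
    (total n1 v) (total n0 v) x y 0.
Proof. by move=> uv; rewrite moved_div0 /den1 (kl_div_split _ _ uv) !addrA. Qed.

(** The rate of decrease of the cost as mass [(x, y)] moves from label v to label u. *)
Definition exchange_slope n0 n1 u v (x y : R) : R :=
  c0 * (kl_slope (total n0 u) (total n1 u) x y - kl_slope (total n0 v) (total n1 v) x y)
    / den0 n0 n1 ^+ 2
  + c1 * (kl_slope (total n1 u) (total n0 u) y x - kl_slope (total n1 v) (total n0 v) y x)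
    / den1 n0 n1 ^+ 2.

Lemma optimal_slope_le0 n0 n1 u v B : optimal n0 n1 -> u != v -> measurable B ->
  total n0 u != 0 -> total n0 v != 0 ->
  exchange_slope n0 n1 u v (n0 v B) (n1 v B) <= 0.
Proof.
move=> [h D0 D1 opt] uv mB pu pv; have [h0 h1 _ _] := h.
have c := allocation_compatible h.
have [pu0 qu0] := compatible_gt0 c pu; have [pv0 qv0] := compatible_gt0 c pv.
move: D0 D1 opt; rewrite /cost /exchange_slope.
rewrite (den0_split _ _ (n0 v B) (n1 v B) uv) (den1_split _ _ (n1 v B) (n0 v B) uv).
move=> D0 D1 opt; apply: slope_le0_of_optimal => //.
- exact: (allots_ge0 h0).
- exact: (allots_ge0 h1).
- exact: (allots_le h0).
- exact: (allots_le h1).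
- move=> e e0 e1; rewrite -(den0_move _ _ _ _ uv) -(den1_move _ _ _ _ uv).
  move=> a0 b0; apply: opt => //.
  by apply: allocation_move => //; rewrite !ltW.
Qed.

(** The likelihood ratio [y / x] for which [exchange_slope] vanishes. *)
Definition crossing n0 n1 u v : R :=
  let k0 := c0 / den0 n0 n1 ^+ 2 in let k1 := c1 / den1 n0 n1 ^+ 2 in
  let ru := total n1 u / total n0 u in let rv := total n1 v / total n0 v in
  (k0 * ln (rv / ru) + k1 * (rv - ru)) / (k0 * (ru^-1 - rv^-1) + k1 * ln (rv / ru)).

(** The rate is linear in [(x, y)]; its coefficients have constant signs because all
    of [rv - ru], [ru^-1 - rv^-1] and [ln (rv / ru)] have the sign of the difference
    of the two likelihood ratios. *)
Lemma slope_crossing n0 n1 u v : optimal n0 n1 ->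
  total n0 u != 0 -> total n0 v != 0 ->
  total n1 u / total n0 u < total n1 v / total n0 v ->
  0 < crossing n0 n1 u v /\ exists2 k, 0 < k &
  forall x y, exchange_slope n0 n1 u v x y = k * (x * crossing n0 n1 u v - y).
Proof.
move=> [h D0 D1 _] pu pv rr.
have c := allocation_compatible h.
have [pu0 qu0] := compatible_gt0 c pu; have [pv0 qv0] := compatible_gt0 c pv.
rewrite /crossing.
set k0 := c0 / _; set k1 := c1 / _.
have k00 : 0 < k0 by rewrite divr_gt0 // exprn_gt0.
have k10 : 0 < k1 by rewrite divr_gt0 // exprn_gt0.
set ru := total n1 u / total n0 u; set rv := total n1 v / total n0 v.
have ru0 : 0 < ru by rewrite divr_gt0.
have rv0 : 0 < rv by rewrite divr_gt0.
set L := ln (rv / ru).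
have L0 : 0 < L by rewrite ln_gt0 // ltr_pdivlMr // mul1r.
have i1 : 0 < ru^-1 - rv^-1 by rewrite subr_gt0 ltf_pV2.
have r1 : 0 < rv - ru by rewrite subr_gt0.
set k := k0 * (ru^-1 - rv^-1) + k1 * L.
have kp : 0 < k by apply: addr_gt0; exact: mulr_gt0.
split; first by rewrite divr_gt0 //; apply: addr_gt0; exact: mulr_gt0.
exists k => // x y; rewrite mulrBr mulrCA [k * (_ / k)]mulrC divfK ?gt_eqF //.
rewrite /exchange_slope !kl_slopeE //.
have -> : total n0 v / total n1 v / (total n0 u / total n1 u) = (rv / ru)^-1.
  by rewrite /ru /rv; field; rewrite !gt_eqF.
rewrite lnV ?posrE ?divr_gt0 // -/ru -/rv -/L.
have -> : total n0 u / total n1 u = ru^-1 by rewrite invf_div.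
have -> : total n0 v / total n1 v = rv^-1 by rewrite invf_div.
by rewrite /k /k0 /k1; ring.
Qed.

Lemma optimal_crossing_le n0 n1 u v B : optimal n0 n1 -> measurable B ->
  total n0 u != 0 -> total n0 v != 0 ->
  total n1 u / total n0 u < total n1 v / total n0 v ->
  n1 u B <= crossing n0 n1 u v * n0 u B /\ crossing n0 n1 u v * n0 v B <= n1 v B.
Proof.
move=> opt mB pu pv rr.
have uv : u != v by apply: contraTneq rr => ->; rewrite ltxx.
have [_ [k k0 E]] := slope_crossing opt pu pv rr.
have neg : forall x y, exchange_slope n0 n1 v u x y = - exchange_slope n0 n1 u v x y.
  by move=> x y; rewrite /exchange_slope; ring.
have vu : v != u by rewrite eq_sym.
split.
  have := optimal_slope_le0 opt vu mB pv pu.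
  by rewrite neg E oppr_le0 pmulr_rge0 // subr_ge0 mulrC.
have := optimal_slope_le0 opt uv mB pu pv.
by rewrite E pmulr_rle0 // subr_le0 mulrC.
Qed.

(** On a set where the likelihood ratio is the crossing of u and v, exchanges
    between u and v are stationary, and a stationary exchange is never optimal. *)
Lemma optimal_atom_null n0 n1 u v B : optimal n0 n1 -> measurable B ->
  total n0 u != 0 -> total n0 v != 0 ->
  total n1 u / total n0 u < total n1 v / total n0 v ->
  (forall w, n1 w B = crossing n0 n1 u v * n0 w B) -> n0 u B = 0 /\ n0 v B = 0.
Proof.
move=> opt mB pu pv rr atom.
have uv : u != v by apply: contraTneq rr => ->; rewrite ltxx.
have vu : v != u by rewrite eq_sym.
have [cr0 [k k0 E]] := slope_crossing opt pu pv rr.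
have [h D0 D1 best] := opt; have [h0 h1 _ _] := h.
have c := allocation_compatible h.
have c' := compatible_sym c.
have [pu0 qu0] := compatible_gt0 c pu; have [pv0 qv0] := compatible_gt0 c pv.
set cr := crossing _ _ _ _ in cr0 E atom.
have stat := E 1 cr; rewrite mul1r subrr mulr0 in stat.
have J0 := merged_kl_ge0 uv c; have J1 := merged_kl_ge0 uv c'.
have J0' := addr_ge0 d0_ge0 J0; have J1' := addr_ge0 d1_ge0 J1.
rewrite addrA in J0'; rewrite addrA in J1'.
move: D0 D1 best stat; rewrite /cost /exchange_slope.
rewrite (den0_split _ _ 1 cr uv) (den1_split _ _ cr 1 uv) => D0 D1 best stat.
have [dl dl0 H] := stationary_move_improves c0_gt0 c1_gt0 pu0 qu0 pv0 qv0 cr0 rr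
  J0' J1' D0 D1 stat.
have moved a0 p q p' q' x y (e : R) : moved_div a0 p q p' q' x y e
   = moved_div a0 p' q' p q x y (- e).
  by rewrite /moved_div !mulNr !opprK addrAC.
have scale1 a0 p q p' q' t s (e : R) : moved_div a0 p q p' q' s (t * s) e
   = moved_div a0 p q p' q' 1 t (e * s) by rewrite /moved_div mulr1 (_ : e * (t * s) = e * s * t) //; ring.
have scale2 a0 p q p' q' t s (e : R) : moved_div a0 p q p' q' (t * s) s e
   = moved_div a0 p q p' q' t 1 (e * s) by rewrite /moved_div mulr1 (_ : e * (t * s) = e * s * t) //; ring.
have pick (x : R) : 0 < x -> exists2 e, 0 < e <= 1 & e * x < dl.
  move=> x0; exists (Num.min 1 (dl / (2 * x))).
    by rewrite lt_min ltr01 divr_gt0 ?mulr_gt0 // ge_min lexx.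
  apply: (@le_lt_trans _ _ (dl / (2 * x) * x)).
    by rewrite ler_pM2r // ge_min lexx orbT.
  by rewrite (_ : dl / (2 * x) * x = dl / 2); [lra|field; rewrite gt_eqF].
have restC p q : kl_rest p q v u = kl_rest p q u v.
  by apply: eq_bigl => w; rewrite andbC.
split; apply/eqP/negPn/negP => n0B.
- have x0 : 0 < n0 u B by rewrite lt_neqAle eq_sym n0B (allots_ge0 h0).
  have [e /andP[e0 e1] edl] := pick _ x0.
  have ne : - (e * n0 u B) != 0 by rewrite oppr_eq0 mulf_neq0 // gt_eqF.
  have nl : `|- (e * n0 u B)| < dl by rewrite normrN gtr0_norm // mulr_gt0.
  have := den1_move n0 n1 B e vu; have := den0_move n0 n1 B e vu.
  rewrite !restC atom scale1 scale2 moved => E0; rewrite moved => E1.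
  have [] := H _ ne nl; rewrite -E0 -E1 => A0 B0; apply/negP; rewrite -leNgt.
  by apply: best => //; apply: allocation_move => //; rewrite e1 ltW.
- have x0 : 0 < n0 v B by rewrite lt_neqAle eq_sym n0B (allots_ge0 h0).
  have [e /andP[e0 e1] edl] := pick _ x0.
  have ne : e * n0 v B != 0 by rewrite mulf_neq0 // gt_eqF.
  have nl : `|e * n0 v B| < dl by rewrite gtr0_norm // mulr_gt0.
  have := den1_move n0 n1 B e uv; have := den0_move n0 n1 B e uv.
  rewrite atom scale1 scale2 => E0 E1.
  have [] := H _ ne nl; rewrite -E0 -E1 => A0 B0; apply/negP; rewrite -leNgt.
  by apply: best => //; apply: allocation_move => //; rewrite e1 ltW.
Qed.
End Optimality.

(** * Threshold rules from separated labels *)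

Lemma find_first_failure (b : nat -> bool) (m j : nat) :
  (forall i l, (0 < i)%N -> (i <= l)%N -> (l <= m)%N -> b l -> b i) -> (j <= m)%N ->
  (find (fun i => ~~ b i.+1) (iota 0 m) == j) =
  ((0 < j)%N ==> b j) && ((j < m)%N ==> ~~ b j.+1).
Proof.
move=> mono jm; set s := iota 0 m; set a := fun i => ~~ b i.+1.
have fle : (find a s <= m)%N by rewrite -[X in (_ <= X)%N](size_iota 0) find_size.
have before i : (i < find a s)%N -> b i.+1.
  move=> h; have := before_find 0%N h.
  by rewrite nth_iota ?add0n /a => [/negbFE|]; last exact: leq_trans h fle.
have at_find : (find a s < m)%N -> ~~ b (find a s).+1.
  move=> h; have := @nth_find _ 0%N a s.
  by rewrite has_find size_iota nth_iota // add0n; exact.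
apply/eqP/andP => [<-|[/implyP b1 /implyP b2]].
  split; apply/implyP => //.
  by case E : (find a s) => [//|i] _; apply: before; rewrite E.
apply/eqP; rewrite eqn_leq; apply/andP; split; rewrite leqNgt; apply/negP => h.
  by have := b2 (leq_trans h fle); rewrite before.
have := at_find (leq_trans h jm).
by rewrite (mono _ j) // b1 // (leq_ltn_trans _ h).
Qed.

Lemma sorting_perm (R : realType) (K : nat) (k : 'I_K -> R) : injective k ->
  exists s : {perm 'I_K}, forall i j : 'I_K, (i < j)%N -> k (s i) < k (s j).
Proof.
move=> ik; pose t := sort (fun u v => k u <= k v) (enum 'I_K).
have st : size t = K by rewrite size_sort size_enum_ord.
have ut : uniq t by rewrite sort_uniq enum_uniq.
have fi : injective (fun i : 'I_K => nth i t i).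
move=> i j /= e; apply: ord_inj; apply/eqP.
  rewrite -(nth_uniq i _ _ ut) ?st // e; apply/eqP.
  by apply: set_nth_default; rewrite st.
exists (perm fi) => i j ij; rewrite !permE.
rewrite lt_neqAle; apply/andP; split.
  apply: contraTneq ij => /ik; rewrite (set_nth_default j) ?st // => /eqP.
  by rewrite nth_uniq ?st // => /eqP ->; rewrite ltnn.
have so : sorted (fun u v => k u <= k v) t by apply: sort_sorted => u v; exact: le_total.
rewrite (set_nth_default j) ?st //.
apply: (sorted_leq_nth _ _ j so) => //; [|by rewrite inE st|by rewrite inE st|exact: ltnW].
by move=> u v w; exact: le_trans.
Qed.

Section Thresholds.
Context {d : measure_display} {X : measurableType d} {R : realType} {K' : nat}.
Local Notation K := K'.+1.
Context {mu : {measure set X -> \bar R}} {P0 P1 : probability X R} {f0 f1 : X -> R}.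
Hypotheses (hf0 : is_density mu P0 f0) (hf1 : is_density mu P1 f1).
Hypotheses (ac01 : P0 `<< P1) (ac10 : P1 `<< P0).

Lemma measurable_le0 (f : X -> R) : measurable_fun setT f -> measurable [set x | f x <= 0].
Proof.
move=> mf; have := @measurable_ratio_le _ _ _ f (cst 0) 1 1 mf (measurable_cst _).
by under eq_set do rewrite !mul1r.
Qed.

Lemma ae_of_pos_density (Q : X -> Prop) :
  (forall x, 0 < f0 x -> Q x) -> {ae P0, forall x, Q x}.
Proof.
move=> H; have [mf0 _ _] := hf0.
exists [set x | f0 x <= 0]; split.
- exact: measurable_le0.
- by rewrite (prE P0 (measurable_le0 mf0)) (pr_density0 hf0).
- by move=> x /= nQ; rewrite leNgt; apply/negP => /H.
Qed.

Section Rule.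
Context {s : {perm 'I_K}} {thr : nat -> R}.
Hypothesis thr_lt : forall l, (0 < l)%N -> (l.+1 < K)%N -> thr l < thr l.+1.

Lemma thr_le i l : (0 < i)%N -> (i <= l)%N -> (l <= K')%N -> thr i <= thr l.
Proof.
move=> i0; elim: l => [|l IH]; first by rewrite leqn0 => /eqP ->.
rewrite leq_eqVlt => /predU1P[->//|]; rewrite ltnS => il lK.
apply: le_trans (IH il (ltnW lK)) _.
by apply/ltW/thr_lt => //; exact: leq_trans i0 il.
Qed.

(** Thresholds are compared with the likelihood ratio in a form without division,
    which is monotone in the threshold also where [f0] vanishes. *)
Definition above x l : bool := thr l * f0 x <= f1 x.
Definition cell_index x : nat := find (fun l => ~~ above x l.+1) (iota 0 K').
Definition threshold_quantizer x : 'I_K := s (inord (cell_index x)).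

Definition cell (l : 'I_K) : set X :=
  [set x | ((0 < l)%N ==> above x l) && ((l < K')%N ==> ~~ above x l.+1)].

Lemma cellP x (l : 'I_K) : threshold_quantizer x = s l <-> cell l x.
Proof.
have [_ f00 _] := hf0.
have fle : (cell_index x < K)%N.
  by rewrite ltnS -[X in (_ <= X)%N](size_iota 0) find_size.
have mono i m : (0 < i)%N -> (i <= m)%N -> (m <= K')%N -> above x m -> above x i.
  by move=> i0 im mK; apply: le_trans; rewrite ler_wpM2r // thr_le.
have lK : (l <= K')%N by rewrite -ltnS.
rewrite /cell /= -(find_first_failure mono lK) /threshold_quantizer.
split=> [/perm_inj <-|/eqP E]; first by rewrite inordK.
by congr (s _); apply: val_inj; rewrite /= inordK.
Qed.

Lemma measurable_cell l : measurable (cell l).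
Proof.
have [mf0 _ _] := hf0; have [mf1 _ _] := hf1.
have mab m : measurable [set x | above x m].
  have := @measurable_ratio_le _ _ _ f0 f1 (thr m) 1 mf0 mf1.
  by under eq_set do rewrite mul1r.
rewrite (_ : cell l = (if (0 < l)%N then [set x | above x l] else setT) `&`
   (if (l < K')%N then ~` [set x | above x l.+1] else setT)).
  apply: measurableI; case: ifP => // _; exact: measurableC.
apply/seteqP; split=> x; rewrite /cell /=.
  move=> /andP[]; case: ltnP => _; case: ltnP => _ /=; split=> //; exact/negP.
move=> [A B]; apply/andP; split; apply/implyP => h.
  by move: A; rewrite h.
by move: B; rewrite h => /negP.
Qed.

Lemma quantizer_threshold : quantizer threshold_quantizer.
Proof.
move=> B; rewrite (_ : _ @^-1` B = \big[setU/set0]_(l < K | `[< B (s l) >]) cell l).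
  by apply: bigsetU_measurable => l _; exact: measurable_cell.
rewrite -bigcup_seq_cond; apply/seteqP; split=> x /=.
  move=> Bx; exists ((s^-1)%g (threshold_quantizer x)) => /=.
    by rewrite mem_index_enum; apply/asboolP; rewrite permKV.
  by apply/cellP; rewrite permKV.
by move=> [l /= /andP[_ /asboolP Bl] /cellP ->].
Qed.

Lemma lr_threshold_rule_threshold : lr_threshold_rule P0 f0 f1 threshold_quantizer.
Proof.
have [_ f00 _] := hf0.
pose thrE l : \bar R := if l == 0%N then -oo%E else if (l < K)%N then (thr l)%:E else +oo%E.
have thrE_in (l : nat) : (0 < l)%N -> (l < K)%N -> thrE l = (thr l)%:E.
  by move=> l0 lK; rewrite /thrE gtn_eqF // lK.
exists thrE, s; split.
- by [].
- by rewrite /thrE /= ltnn.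
- move=> l lK; rewrite /thrE; case: (posnP l) => [->|l0] /=.
    by case: ifP => _; rewrite ?ltNyr.
  rewrite lK; case: ifP => [l1|_]; last exact: ltry.
  by rewrite lte_fin thr_lt.
- apply: ae_of_pos_density => x x0 l /andP[A B].
  apply/cellP/andP; split; apply/implyP => h.
    move: A; rewrite thrE_in // lte_fin ltr_pdivlMr // => /ltW.
    by rewrite /above.
  move: B; rewrite thrE_in // lte_fin ltr_pdivrMr //.
  by rewrite /above -ltNge.
- move=> l m ml; right; apply: ae_of_pos_density => x x0.
  have m0 : (0 < m)%N by rewrite ml.
  rewrite thrE_in // => -[E].
  have {}E : f1 x = thr m * f0 x by rewrite -E divfK // gt_eqF.
  apply/cellP/andP; split; apply/implyP => h; rewrite /above E //.
  by rewrite -ltNge ltr_pM2r // thr_lt.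
Qed.

Context {n0 n1 : 'I_K -> set X -> R}.
Hypothesis hn : allocation P0 P1 f0 f1 n0 n1.
Hypothesis null_below : forall l : 'I_K, (0 < l)%N ->
  n0 (s l) [set x | 1 * f1 x < thr l * f0 x] = 0.
Hypothesis null_above : forall l : 'I_K, (l < K')%N ->
  n0 (s l) [set x | thr l.+1 * f0 x <= 1 * f1 x] = 0.

Lemma null_out_of_cell (l : 'I_K) : n0 (s l) (~` cell l) = 0.
Proof.
have [mf0 _ _] := hf0; have [mf1 _ _] := hf1; have [h0 _ _ _] := hn.
pose A := if (0 < l)%N then [set x | 1 * f1 x < thr l * f0 x] else set0.
pose B := if (l < K')%N then [set x | thr l.+1 * f0 x <= 1 * f1 x] else set0.
have mA : measurable A by rewrite /A; case: ifP => // _; exact: measurable_ratio_lt.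
have mB : measurable B by rewrite /B; case: ifP => // _; exact: measurable_ratio_le.
apply: (allots_null_le h0 (B := A `|` B)).
- exact/measurableC/measurable_cell.
- exact: measurableU.
- move=> x; rewrite /cell /= => /negP; rewrite negb_and !negb_imply => /orP[]/andP[l0 ab].
    by left; rewrite /A l0 /= mul1r ltNge; exact: ab.
  by right; rewrite /B l0 /= mul1r; case/andP: ab.
- apply: (allots_null_setU h0) => //.
    rewrite /A; case: ifP => l0; [exact: null_below|exact: (allots0 h0)].
  rewrite /B; case: ifP => l0; [exact: null_above|exact: (allots0 h0)].
Qed.

Lemma induced_pmf_threshold (P : probability X R) (n : 'I_K -> set X -> R) :
  allots P n ->
  (forall l : 'I_K, n (s l) (~` cell l) = 0) ->
  induced_pmf P threshold_quantizer = total n.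
Proof.
move=> h n0out; apply/funext => u; rewrite -(permKV s u); set l := (s^-1)%g u.
have mC m : measurable (~` cell m) by exact/measurableC/measurable_cell.
have -> : induced_pmf P threshold_quantizer (s l) = pr P (cell l).
  rewrite /induced_pmf /pr; congr (fine (P _)).
  by apply/seteqP; split=> x /cellP.
rewrite -(allots_sum h (measurable_cell l)) (bigD1 (s l)) //= big1 ?addr0.
  rewrite /total (allots_split h _ measurableT (measurable_cell l)) setTI setTD.
  by rewrite n0out addr0.
move=> w; rewrite -(permKV s w); set m := (s^-1)%g w => wl.
apply: (allots_null_le h (B := ~` cell m)) => //; first exact: measurable_cell.
by move=> x /cellP xl /cellP xm; move: wl; rewrite -xl -xm eqxx.
Qed.

Lemma threshold_rule_exists : exists phi : X -> 'I_K,
  [/\ quantizer phi, lr_threshold_rule P0 f0 f1 phi,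
   induced_pmf P0 phi = total n0 & induced_pmf P1 phi = total n1].
Proof.
have [h0 h1 _ _] := hn.
exists threshold_quantizer; split.
- exact: quantizer_threshold.
- exact: lr_threshold_rule_threshold.
- exact: (induced_pmf_threshold h0 null_out_of_cell).
- apply: (induced_pmf_threshold h1) => l.
  apply: (allocation_ac hf0 hf1 ac10 hn); last exact: null_out_of_cell.
  exact/measurableC/measurable_cell.
Qed.

End Rule.
End Thresholds.

(** * Optimal allocations are threshold rules *)

Lemma merging_lossC (R : realType) (p q p' q' : R) :
  merging_loss p q p' q' = merging_loss p' q' p q.
Proof. by rewrite /merging_loss [p' + p]addrC [q' + q]addrC; ring. Qed.

Lemma merging_loss_gt0 (R : realType) (p q p' q' : R) :
  0 < p -> 0 < q -> 0 < p' -> 0 < q' -> q * p' != q' * p -> 0 < merging_loss p q p' q'.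
Proof.
wlog lt : p q p' q' / q * p' < q' * p => [H p0 q0 p0' q0' ne|p0 q0 p0' q0' _].
  have [lt|gt|e] := ltgtP (q * p') (q' * p); first exact: H.
    by rewrite merging_lossC; apply: H => //; rewrite eq_sym.
  by rewrite e eqxx in ne.
have z0 : 0 < (q' * p) / (p' * q) - 1.
  by rewrite subr_gt0 ltr_pdivlMr ?mulr_gt0 // mul1r mulrC.
have zE : 1 + ((q' * p) / (p' * q) - 1) = (q' * p) / (p' * q) by ring.
by have [_ []] := merging_loss_inv_le p0 q0 p0' q0' z0 zE erefl.
Qed.

Section ThresholdOfOptimal.
Context {d : measure_display} {X : measurableType d} {R : realType} {K' : nat}.
Local Notation K := K'.+1.
Context {mu : {measure set X -> \bar R}} {P0 P1 : probability X R} {f0 f1 : X -> R}.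
Hypotheses (hf0 : is_density mu P0 f0) (hf1 : is_density mu P1 f1).
Hypotheses (ac01 : P0 `<< P1) (ac10 : P1 `<< P0).
Context {c0 c1 d0 d1 : R}.
Hypotheses (c0_gt0 : 0 < c0) (c1_gt0 : 0 < c1) (d0_ge0 : 0 <= d0) (d1_ge0 : 0 <= d1).
Implicit Types (n m : 'I_K -> set X -> R) (u v w : 'I_K) (A B : set X).
Local Notation alloc := (@allocation d X R K P0 P1 f0 f1).
Local Notation opt := (@optimal d X R K P0 P1 f0 f1 c0 c1 d0 d1).
Local Notation cross := (@crossing d X R K c0 c1 d0 d1).
Local Notation ratio n0 n1 u := (total n1 u / total n0 u).

Lemma null_lt_le n0 n1 u (c c' : R) : alloc n0 n1 -> c' <= c ->
  n0 u [set x | 1 * f1 x < c * f0 x] = 0 -> n0 u [set x | 1 * f1 x < c' * f0 x] = 0.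
Proof.
have [mf0 f00 _] := hf0; have [mf1 _ _] := hf1.
move=> [h0 _ _ _] cc; apply: (allots_null_le h0); try exact: measurable_ratio_lt.
by move=> x /= /lt_le_trans; apply; rewrite ler_wpM2r.
Qed.

Lemma null_ge_of_gt n0 n1 u (c c' : R) : alloc n0 n1 -> c < c' ->
  n0 u [set x | c * f0 x < 1 * f1 x] = 0 -> n0 u [set x | c' * f0 x <= 1 * f1 x] = 0.
Proof.
have [mf0 f00 _] := hf0; have [mf1 f10 _] := hf1.
move=> [h0 _ _ _] cc N.
have mZ := measurable_le0 mf0.
have mL : measurable [set x | c * f0 x < 1 * f1 x] by exact: measurable_ratio_lt.
apply: (allots_null_le h0 (B := [set x | c * f0 x < 1 * f1 x] `|` [set x | f0 x <= 0])).
- exact: measurable_ratio_le.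
- exact: measurableU.
- move=> x /= le; have [x0|x0] := leP (f0 x) 0; [by right|left].
  by apply: lt_le_trans le; rewrite ltr_pM2r.
- apply: (allots_null_setU h0) => //.
  apply/eqP; rewrite eq_le (allots_ge0 h0) // andbT.
  by apply: (le_trans (allots_le_pr h0 u mZ)); rewrite (pr_density0 hf0).
Qed.

Lemma optimal_separated n0 n1 u v : opt n0 n1 ->
  total n0 u != 0 -> total n0 v != 0 -> ratio n0 n1 u < ratio n0 n1 v ->
  n0 u [set x | cross n0 n1 u v * f0 x <= 1 * f1 x] = 0 /\
  n0 v [set x | 1 * f1 x <= cross n0 n1 u v * f0 x] = 0.
Proof.
move=> o pu pv rr; have [h _ _ _] := o; have [h0 _ _ _] := h.
have [mf0 f00 _] := hf0; have [mf1 f10 _] := hf1.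
have [cr0 _] := slope_crossing hf0 hf1 ac01 ac10 c0_gt0 c1_gt0 o pu pv rr.
set cr := cross n0 n1 u v in cr0 *.
pose G := [set x | cr * f0 x < 1 * f1 x]; pose L := [set x | 1 * f1 x < cr * f0 x].
pose B := [set x | cr * f0 x <= 1 * f1 x] `&` [set x | 1 * f1 x <= cr * f0 x].
have mG : measurable G by exact: measurable_ratio_lt.
have mL : measurable L by exact: measurable_ratio_lt.
have mB : measurable B by apply: measurableI; exact: measurable_ratio_le.
have [B1 B2] : n0 u B = 0 /\ n0 v B = 0.
  apply: (optimal_atom_null hf0 hf1 ac01 ac10 c0_gt0 c1_gt0 d0_ge0 d1_ge0 o) => // w.
  apply: (allocation_eq_ratio w h (ltW cr0) mB) => x [/= le ge].
  by apply/eqP; rewrite eq_le -[f1 x]mul1r le ge.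
have G0 : n0 u G = 0.
  apply: (allocation_null_gt hf0 hf1 ac01 h cr0) => A mA.
  exact: (optimal_crossing_le hf0 hf1 ac01 ac10 c0_gt0 c1_gt0 o mA pu pv rr).1.
have L0 : n0 v L = 0.
  apply: (allocation_null_lt hf0 hf1 h cr0) => A mA.
  exact: (optimal_crossing_le hf0 hf1 ac01 ac10 c0_gt0 c1_gt0 o mA pu pv rr).2.
split.
- apply: (allots_null_le h0 (B := G `|` B)); [exact: measurable_ratio_le|exact: measurableU| |].
    move=> x /= le; have [lt|ge] := ltP (cr * f0 x) (1 * f1 x); first by left.
    by right.
  exact: (allots_null_setU h0).
- apply: (allots_null_le h0 (B := L `|` B)); [exact: measurable_ratio_le|exact: measurableU| |].
    move=> x /= le; have [lt|ge] := ltP (1 * f1 x) (cr * f0 x); first by left.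
    by right.
  exact: (allots_null_setU h0).
Qed.

(** With v empty, the part of w in B can be given the label v. This would increase
    both divergences strictly if B and its complement had different ratios in w. *)
Lemma optimal_pure n0 n1 v w B : opt n0 n1 -> total n0 v = 0 -> total n0 w != 0 ->
  measurable B -> n1 w B = ratio n0 n1 w * n0 w B.
Proof.
move=> o pv pw mB; have [h D0 D1 best] := o; have [h0 h1 _ _] := h.
have c := allocation_compatible hf0 hf1 ac01 ac10 h.
have [pw0 qw0] := compatible_gt0 c pw.
have qv : total n1 v = 0 by case: c => _ _ /(_ v)[+ _] _; exact.
have vw : v != w by apply: contraNneq pw => <-; rewrite pv.
have ac A : measurable A -> n0 w A = 0 -> n1 w A = 0.
  exact: (allocation_ac hf0 hf1 ac10 h).
have ac' A : measurable A -> n1 w A = 0 -> n0 w A = 0.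
  exact: (allocation_ac hf1 hf0 ac01 (allocation_sym h)).
have [x0|x0] := eqVneq (n0 w B) 0; first by rewrite x0 ac // mulr0.
have mBC : measurable (~` B) by exact: measurableC.
have pE : total n0 w = n0 w B + n0 w (~` B).
  by rewrite /total (allots_split h0 _ measurableT mB) setTI setTD.
have qE : total n1 w = n1 w B + n1 w (~` B).
  by rewrite /total (allots_split h1 _ measurableT mB) setTI setTD.
have [x1|x1] := eqVneq (n0 w (~` B)) 0.
  rewrite pE qE x1 (ac _ mBC x1) !addr0 divfK //.
have gt0 (r : R) : 0 <= r -> r != 0 -> 0 < r by move=> r0 r1; rewrite lt_neqAle eq_sym r1.
have X0 : 0 < n0 w B by apply: gt0 => //; exact: (allots_ge0 h0).
have X1 : 0 < n0 w (~` B) by apply: gt0 => //; exact: (allots_ge0 h0).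
have Y0 : 0 < n1 w B.
  by apply: gt0; [exact: (allots_ge0 h1)|apply: contra x0 => /eqP /(ac' _ mB) /eqP].
have Y1 : 0 < n1 w (~` B).
  by apply: gt0; [exact: (allots_ge0 h1)|apply: contra x1 => /eqP /(ac' _ mBC) /eqP].
apply/eqP; rewrite -(inj_eq (mulfI pw)).
have -> : total n0 w * (ratio n0 n1 w * n0 w B) = total n1 w * n0 w B.
  by field; rewrite gt_eqF.
rewrite -subr_eq0 pE qE.
have -> : (n0 w B + n0 w (~` B)) * n1 w B - (n1 w B + n1 w (~` B)) * n0 w B
  = n1 w B * n0 w (~` B) - n1 w (~` B) * n0 w B by ring.
rewrite subr_eq0; apply/negPn/negP => ne.
have l0 := merging_loss_gt0 X0 Y0 X1 Y1 ne.
have l1 : 0 < merging_loss (n1 w B) (n0 w B) (n1 w (~` B)) (n0 w (~` B)).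
  apply: merging_loss_gt0 => //; apply: contra ne => /eqP ne.
  by apply/eqP; rewrite mulrC -ne mulrC.
have e01 : 0 <= (1 : R) <= 1 by rewrite ler01 lexx.
have hm := allocation_move h vw mB e01.
have E0 : den0 (d0 := d0) (move_mass n0 v w B 1) (move_mass n1 v w B 1)
   = den0 (d0 := d0) n0 n1 + merging_loss (n0 w B) (n1 w B) (n0 w (~` B)) (n1 w (~` B)).
  rewrite den0_move // (den0_split _ _ 0 0 vw) /moved_div /merging_loss pv qv.
  rewrite !mul0r !mul1r !add0r !subr0 -pE -qE.
  have -> : total n0 w - n0 w B = n0 w (~` B) by rewrite pE; ring.
  have -> : total n1 w - n1 w B = n1 w (~` B) by rewrite qE; ring.
  by rewrite [kl_term 0 0]/kl_term mul0r; ring.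
have E1 : den1 (d1 := d1) (move_mass n0 v w B 1) (move_mass n1 v w B 1)
   = den1 (d1 := d1) n0 n1 + merging_loss (n1 w B) (n0 w B) (n1 w (~` B)) (n0 w (~` B)).
  rewrite den1_move // (den1_split _ _ 0 0 vw) /moved_div /merging_loss pv qv.
  rewrite !mul0r !mul1r !add0r !subr0 -pE -qE.
  have -> : total n0 w - n0 w B = n0 w (~` B) by rewrite pE; ring.
  have -> : total n1 w - n1 w B = n1 w (~` B) by rewrite qE; ring.
  by rewrite [kl_term 0 0]/kl_term mul0r; ring.
have := best _ _ hm; rewrite /cost E0 E1 => /(_ (addr_gt0 D0 l0) (addr_gt0 D1 l1)).
apply/negP; rewrite -ltNge; have P0' := addr_gt0 D0 l0; have P1' := addr_gt0 D1 l1.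
by apply: ltrD; rewrite ltr_pM2l // ltf_pV2 // ltrDl.
Qed.

(** Sorted by likelihood ratio, the labels are separated by the crossings of
    neighbours; since no label is empty, these crossings increase strictly. *)
Lemma optimal_threshold_full n0 n1 : opt n0 n1 -> (forall u, total n0 u != 0) ->
  (forall u v, u != v -> ratio n0 n1 u != ratio n0 n1 v) ->
  exists phi : X -> 'I_K, [/\ quantizer phi, lr_threshold_rule P0 f0 f1 phi,
   induced_pmf P0 phi = total n0 & induced_pmf P1 phi = total n1].
Proof.
move=> o full dist; have [h _ _ _] := o; have [h0 _ _ _] := h.
have [mf0 f00 _] := hf0; have [mf1 _ _] := hf1.
have inj : injective (fun u => ratio n0 n1 u).
  by move=> u v e; apply: contraTeq isT => /dist; rewrite e eqxx.
have [s smono] := sorting_perm inj.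
pose lab i : 'I_K := s (inord i).
pose thr i := cross n0 n1 (lab i.-1) (lab i).
have labE (l : 'I_K) : lab l = s l by rewrite /lab inord_val.
have sep i : (0 < i)%N -> (i < K)%N ->
    n0 (lab i.-1) [set x | thr i * f0 x <= 1 * f1 x] = 0 /\
    n0 (lab i) [set x | 1 * f1 x <= thr i * f0 x] = 0.
  move=> i0 iK; apply: optimal_separated => //.
  have iK' : (i.-1 < K)%N by exact: leq_ltn_trans (leq_pred i) iK.
  by apply: smono; rewrite (inordK iK) (inordK iK') prednK.
have sep_lt i : (0 < i)%N -> (i < K)%N ->
    n0 (lab i) [set x | 1 * f1 x < thr i * f0 x] = 0.
  move=> i0 iK; apply: (allots_null_le h0 _ _ _ (sep i i0 iK).2).
  - exact: measurable_ratio_lt.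
  - exact: measurable_ratio_le.
  - by move=> x /= /ltW.
have thr_lt l : (0 < l)%N -> (l.+1 < K)%N -> thr l < thr l.+1.
  move=> l0 lK; rewrite ltNge; apply/negP => le.
  have := full (lab l); rewrite /total; apply/negP; rewrite negbK; apply/eqP.
  apply: (allots_null_le h0
    (B := [set x | 1 * f1 x <= thr l * f0 x] `|` [set x | thr l.+1 * f0 x <= 1 * f1 x])) => //.
  - by apply: measurableU; exact: measurable_ratio_le.
  - move=> x _ /=; have [|/ltW ge] := leP (1 * f1 x) (thr l * f0 x); first by left.
    by right; apply: le_trans ge; rewrite ler_wpM2r.
  - apply: (allots_null_setU h0); try exact: measurable_ratio_le.
      exact: (sep l l0 (ltnW lK)).2.
    exact: (sep l.+1 isT lK).1.
apply: (threshold_rule_exists hf0 hf1 ac10 (s := s) thr_lt h) => l hl.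
- by rewrite -labE; apply: sep_lt.
- by rewrite -labE; apply: (sep l.+1 isT _).1.
Qed.

(** The likelihood ratio is constant on every nonempty label. The empty labels are
    given distinct keys above all ratios, to make room for the missing thresholds. *)
Lemma optimal_threshold_spare n0 n1 v : opt n0 n1 -> total n0 v = 0 ->
  (forall u w, u != w -> total n0 u != 0 -> total n0 w != 0 ->
     ratio n0 n1 u != ratio n0 n1 w) ->
  exists phi : X -> 'I_K, [/\ quantizer phi, lr_threshold_rule P0 f0 f1 phi,
   induced_pmf P0 phi = total n0 & induced_pmf P1 phi = total n1].
Proof.
move=> o v0 dist; have [h _ _ _] := o; have [h0 _ _ _] := h.
have c := allocation_compatible hf0 hf1 ac01 ac10 h.
have [mf0 f00 _] := hf0; have [mf1 _ _] := hf1.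
pose M := \sum_u ratio n0 n1 u.
have r0 u : 0 <= ratio n0 n1 u by case: c => p0 q0 _ _; rewrite divr_ge0.
have rM u : ratio n0 n1 u <= M.
  by rewrite /M (bigD1 u) //= lerDl sumr_ge0.
pose key u := if total n0 u == 0 then M + 1 + (u : nat)%:R else ratio n0 n1 u.
have big u w : ratio n0 n1 u < M + 1 + (w : nat)%:R.
  have : 0 <= (w : nat)%:R :> R by exact: ler0n.
  by have := rM u; lra.
have inj : injective key.
  move=> u w; rewrite /key; case: eqVneq => [u0|u0]; case: eqVneq => [w0|w0].
  - by move=> /addrI /eqP; rewrite eqr_nat => /eqP /val_inj.
  - by move=> e; have := big w u; rewrite e ltxx.
  - by move=> e; have := big u w; rewrite e ltxx.
  - by move=> e; apply: contraTeq isT => /dist /(_ u0 w0); rewrite e eqxx.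
have [s smono] := sorting_perm inj.
pose kk i := key (s (inord i)).
pose thr i := (kk i.-1 + kk i) / 2.
have kkE (l : 'I_K) : kk l = key (s l) by rewrite /kk inord_val.
have kk_lt i : (i.+1 < K)%N -> kk i < kk i.+1.
  by move=> iK; apply: smono; rewrite !inordK //; exact: ltnW.
have null_empty u A : measurable A -> total n0 u = 0 -> n0 u A = 0.
  by move=> mA; apply: (allots_null_le h0).
have pure u B : total n0 u != 0 -> measurable B -> n1 u B = key u * n0 u B.
  by move=> u0 mB; rewrite /key (negbTE u0); exact: (optimal_pure o v0).
have key0 u : total n0 u != 0 -> 0 < key u.
  move=> u0; rewrite /key (negbTE u0).
  by have [p0 q0] := compatible_gt0 c u0; rewrite divr_gt0.
apply: (threshold_rule_exists hf0 hf1 ac10 (s := s) (thr := thr) _ h) => l.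
- case: l => // l _ lK; rewrite /thr /=.
  by have := kk_lt l (ltnW lK); have := kk_lt l.+1 lK; lra.
- move=> l0; have [e|ne] := eqVneq (total n0 (s l)) 0.
    by apply: null_empty e; exact: measurable_ratio_lt.
  apply: (@null_lt_le _ n1 _ (key (s l))) => //.
    have lK : (l.-1.+1 < K)%N by rewrite prednK.
    by have := kk_lt _ lK; rewrite prednK // /thr kkE; lra.
  apply: (allocation_null_lt hf0 hf1 h); first exact: key0.
  by move=> B mB; rewrite pure.
- move=> lK; have [e|ne] := eqVneq (total n0 (s l)) 0.
    by apply: null_empty e; exact: measurable_ratio_le.
  apply: (@null_ge_of_gt _ n1 _ (key (s l))) => //.
    by have := kk_lt _ (lK : (l.+1 < K)%N); rewrite /thr /= kkE; lra.
  apply: (allocation_null_gt hf0 hf1 ac01 h); first exact: key0.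
  by move=> B mB; rewrite pure.
Qed.

Lemma kl_term_merge (p q p' q' : R) : 0 < p -> 0 < q -> 0 < p' -> 0 < q' ->
  q / p = q' / p' -> kl_term (p + p') (q + q') = kl_term p q + kl_term p' q'.
Proof.
move=> p0 q0 p0' q0' e.
have qE : q = q' / p' * p by rewrite -e divfK ?gt_eqF.
have r1 : p / q = p' / q' by rewrite -invf_div e invf_div.
have r2 : (p + p') / (q + q') = p' / q'.
  have s0 : 0 < p + p' by exact: addr_gt0.
  have -> : q + q' = q' / p' * (p + p') by rewrite qE; field; rewrite gt_eqF.
  by field; rewrite !gt_eqF.
by rewrite /kl_term r1 r2 mulrDl.
Qed.

(** Merging two labels of equal ratio changes neither divergence and empties one of
    them, so the number of nonempty labels decreases. *)
Lemma optimal_threshold n0 n1 : opt n0 n1 ->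
  exists phi : X -> 'I_K, [/\ quantizer phi, lr_threshold_rule P0 f0 f1 phi,
   div0 P0 P1 phi = kl_div (total n0) (total n1) &
   div1 P0 P1 phi = kl_div (total n1) (total n0)].
Proof.
have [k] := ubnP #|[set u : 'I_K | total n0 u != 0]%SET|.
elim: k => // k IH in n0 n1 *; rewrite ltnS => card o.
have [h D0 D1 best] := o; have [h0 h1 _ _] := h.
have c := allocation_compatible hf0 hf1 ac01 ac10 h.
have finish : (exists phi : X -> 'I_K, [/\ quantizer phi, lr_threshold_rule P0 f0 f1 phi,
   induced_pmf P0 phi = total n0 & induced_pmf P1 phi = total n1]) ->
  exists phi : X -> 'I_K, [/\ quantizer phi, lr_threshold_rule P0 f0 f1 phi,
   div0 P0 P1 phi = kl_div (total n0) (total n1) &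
   div1 P0 P1 phi = kl_div (total n1) (total n0)].
  by move=> [phi [q t e0 e1]]; exists phi; split; rewrite // ?/div0 ?/div1 e0 e1.
have [/existsP[u /existsP[v /and4P[uv pu pv /eqP e]]]|nomerge] := boolP
   [exists u : 'I_K, exists v : 'I_K,
     [&& u != v, total n0 u != 0, total n0 v != 0 & ratio n0 n1 u == ratio n0 n1 v]].
  have [pu0 qu0] := compatible_gt0 c pu; have [pv0 qv0] := compatible_gt0 c pv.
  have e01 : 0 <= (1 : R) <= 1 by rewrite ler01 lexx.
  set m0 := move_mass n0 u v setT 1; set m1 := move_mass n1 u v setT 1.
  have hm : alloc m0 m1 by exact: allocation_move.
  have rev (p q : R) : p / q = (q / p)^-1 by rewrite invf_div.
  have k0 : kl_div (total m0) (total m1) = kl_div (total n0) (total n1).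
    rewrite !total_move kl_div_shift // !mul1r -/(total n0 v) -/(total n1 v) !subrr.
    rewrite (kl_term_merge pu0 qu0 pv0 qv0 e) (kl_div_split _ _ uv).
    by rewrite [kl_term 0 0]/kl_term mul0r addr0 addrA.
  have k1 : kl_div (total m1) (total m0) = kl_div (total n1) (total n0).
    rewrite !total_move kl_div_shift // !mul1r -/(total n0 v) -/(total n1 v) !subrr.
    rewrite (kl_term_merge qu0 pu0 qv0 pv0) ?(kl_div_split _ _ uv); last first.
      by rewrite rev e -rev.
    by rewrite [kl_term 0 0]/kl_term mul0r addr0 addrA.
  have om : opt m0 m1.
    by split=> //; rewrite /cost /den0 /den1 ?k0 ?k1.
  rewrite -k0 -k1; apply: IH om; apply: leq_trans card.
  apply: proper_card; apply/properP; split.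
    apply/fintype.subsetP => w; rewrite !inE; apply: contra => /eqP w0.
    rewrite /m0 total_move /shift_mass w0.
    have wu : w == u = false by apply: contraNF pu => /eqP <-; rewrite w0.
    have wv : w == v = false by apply: contraNF pv => /eqP <-; rewrite w0.
    by rewrite wu wv addr0 subr0.
  exists v; rewrite !inE // negbK /m0 total_move /shift_mass eqxx.
  have -> : (v == u) = false by rewrite eq_sym; exact: negbTE.
  by rewrite mul1r addr0 -/(total n0 v) subrr.
have dist u w : u != w -> total n0 u != 0 -> total n0 w != 0 ->
    ratio n0 n1 u != ratio n0 n1 w.
  move=> uw u0 w0; apply: contraNneq nomerge => e.
  by apply/existsP; exists u; apply/existsP; exists w; rewrite uw u0 w0 e eqxx.
apply: finish.
have [/existsP[v /eqP v0]|full] := boolP [exists v, total n0 v == 0].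
  exact: (optimal_threshold_spare o v0).
have full' u : total n0 u != 0 by apply: contraNneq full => e; apply/existsP; exists u; rewrite e.
by apply: optimal_threshold_full => // u v uv; exact: dist.
Qed.

End ThresholdOfOptimal.

(** * Consequences of the bound on the variances *)

Lemma induced_llrC (d : measure_display) (X : measurableType d) (R : realType) (K : nat)
    (P0 P1 : probability X R) (phi : X -> 'I_K) u :
  induced_llr P1 P0 phi u = - induced_llr P0 P1 phi u.
Proof.
rewrite /induced_llr -[X in ln X]invf_div.
have [z0|z0] := leP (induced_pmf P1 phi u / induced_pmf P0 phi u) 0.
  by rewrite !ln0 ?oppr0 // invr_le0.
by rewrite lnV.
Qed.

Lemma bounded_llr_varianceC (d : measure_display) (X : measurableType d) (R : realType)
    (K : nat) (P0 P1 P : probability X R) :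
  bounded_llr_variance P0 P1 (@quantizer_class d X R K P0 P1) P ->
  bounded_llr_variance P1 P0 (@quantizer_class d X R K P1 P0) P.
Proof.
move=> [V ubV]; exists V => _ [phi [q p0 p1] <-]; apply: ubV; exists phi => //.
rewrite /pmf_var; apply: eq_bigr => u _; congr (_ * _).
have -> : pmf_mean (induced_pmf P phi) (induced_llr P1 P0 phi)
        = - pmf_mean (induced_pmf P phi) (induced_llr P0 P1 phi).
  by rewrite /pmf_mean -sumrN; apply: eq_bigr => w _; rewrite (induced_llrC P0 P1) mulrN.
by rewrite (induced_llrC P0 P1); ring.
Qed.

Lemma pmf_var_ge_binary (R : realType) (K : nat) (p h : 'I_K -> R) (u v : 'I_K) :
  u != v -> (forall w, 0 <= p w) -> p v = 1 - p u ->
  (forall w, w != u -> w != v -> p w = 0) ->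
  p u * (1 - p u) ^+ 2 * (h u - h v) ^+ 2 <= pmf_var p h.
Proof.
move=> uv p0 pv pw.
have mE : pmf_mean p h = p u * h u + (1 - p u) * h v.
  rewrite /pmf_mean (bigD1 u) //= (bigD1 v) /=; last by rewrite eq_sym.
  by rewrite big1 ?addr0 ?pv // => w /andP[wu wv]; rewrite pw ?mul0r.
rewrite /pmf_var (bigD1 u) //= mE.
have -> : h u - (p u * h u + (1 - p u) * h v) = (1 - p u) * (h u - h v) by ring.
rewrite exprMn -mulrA lerDl; apply: sumr_ge0 => w _.
exact: mulr_ge0 (p0 w) (sqr_ge0 _).
Qed.

Section Tails.
Context {d : measure_display} {X : measurableType d} {R : realType} {K : nat}.
Context {mu : {measure set X -> \bar R}} {P0 P1 : probability X R} {f0 f1 : X -> R}.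
Hypotheses (hf0 : is_density mu P0 f0) (hf1 : is_density mu P1 f1).
Hypotheses (ac01 : P0 `<< P1) (ac10 : P1 `<< P0).
Hypothesis hK : (2 <= K)%N.
Hypothesis var0 : bounded_llr_variance P0 P1 (@quantizer_class d X R K P0 P1) P0.

(** The binary quantizer that singles out the set of ratios below b has a cell of
    mass [p <= 1/2] on which the log-likelihood ratio is at most [ln b], against a
    nonnegative value on the other cell: its variance is at least
    [p / 4 * ln b ^+ 2]. *)
Lemma low_ratio_tail : exists V c : R, [/\ 0 < V, 0 < c & forall b : R, 0 < b -> b <= c ->
  pr P0 [set x | 1 * f1 x < b * f0 x] * ln b ^+ 2 <= V].
Proof.
have [mf0 f00 _] := hf0; have [mf1 f10 _] := hf1; have [V0 ubV] := var0.
pose D k := [set x | 1 * f1 x < k.+1%:R^-1 * f0 x].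
have mD k : measurable (D k) by exact: measurable_ratio_lt.
have ndD k l : (k <= l)%N -> D l `<=` D k.
  move=> kl x /= /lt_le_trans; apply; rewrite ler_wpM2r // lef_pV2 ?posrE ?ltr0n //.
  by rewrite ler_nat.
have mcap : measurable (\bigcap_k D k) by exact: bigcapT_measurable.
have D0 : pr P0 (\bigcap_k D k) = 0.
  apply: (pr_ac ac01 mcap); apply/eqP; rewrite eq_le pr_ge0 andbT.
  rewrite -(pr_density0 hf1); apply: pr_le => //; first exact: measurable_le0.
  move=> x Dx /=; rewrite leNgt; apply/negP => fx.
  have gx : 0 < f0 x.
    by have := Dx 0%N I; rewrite /D /= invr1 !mul1r; exact: lt_trans.
  have := Dx (Num.bound (f0 x / f1 x)) I; rewrite /D /= mul1r mulrC ltr_pdivlMr ?ltr0n //.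
  apply/negP; rewrite -leNgt mulrC -ler_pdivrMr //.
  apply: (@le_trans _ _ (Num.bound (f0 x / f1 x))%:R); last by rewrite ler_nat.
  by apply/ltW/archi_boundP; rewrite divr_ge0 // ltW.
have [k hk] := pr_cvg0 mD ndD D0 (ltac:(lra) : 0 < 2^-1 :> R).
pose c : R := Num.min k.+1%:R^-1 2^-1.
have c0 : 0 < c by rewrite lt_min !invr_gt0 ltr0n //=.
have c2 : c <= 2^-1 by rewrite ge_min lexx orbT.
pose V1 : R := `|V0|; have V1_ge0 : 0 <= V1 by exact: normr_ge0.
have V01 : V0 <= V1 by exact: ler_norm.
exists (4 * (V1 + 1)), c; split => //; first by lra.
move=> b b0 bc.
set A := [set x | _]; have mA : measurable A by exact: measurable_ratio_lt.
set p := pr P0 A; set q := pr P1 A.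
have p2 : p <= 2^-1.
  apply: le_trans (ltW hk); apply: pr_le => // x /lt_le_trans; apply.
  by rewrite ler_wpM2r // (le_trans bc) // ge_min lexx.
have [p0|p0] := eqVneq p 0.
  by rewrite p0 mul0r; lra.
have pgt : 0 < p by rewrite lt_neqAle eq_sym p0 pr_ge0.
have qgt : 0 < q.
  rewrite lt_neqAle pr_ge0 andbT eq_sym; apply: contra p0 => /eqP q0.
  by apply/eqP; exact: (pr_ac ac01 mA).
have qb : q <= b * p.
  rewrite -[q]mul1r; apply: (density_ratio_le hf1 hf0) => //; first exact: ltW.
  by move=> x /ltW.
have b1 : b < 1 by lra.
have qp : q < p by apply: le_lt_trans qb _; rewrite gtr_pMl.
pose u0 : 'I_K := Ordinal (ltn_trans (isT : (0 < 1)%N) hK).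
pose u1 : 'I_K := Ordinal hK.
have u01 : u0 != u1 by [].
pose phi x : 'I_K := if `[< A x >] then u0 else u1.
have pre B : phi @^-1` B = (if `[< B u0 >] then A else set0)
    `|` (if `[< B u1 >] then ~` A else set0).
  apply/seteqP; split=> x; rewrite /phi /=.
    by case: (asboolP (A x)) => Ax Bx; [left|right]; rewrite asboolT.
  by case; case: asboolP => // Bu Ax; [rewrite asboolT|rewrite asboolF].
have qphi : quantizer phi.
  by move=> B; rewrite pre; apply: measurableU; case: ifP => // _; exact: measurableC.
have n01 : ~ [set u0] u1 by move/eqP.
have n10 : ~ [set u1] u0 by move/eqP.
have P_u0 (P : probability X R) : induced_pmf P phi u0 = pr P A.
  by rewrite /induced_pmf /pr pre (asboolT (erefl : [set u0] u0)) (asboolF n01) setU0.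
have P_u1 (P : probability X R) : induced_pmf P phi u1 = 1 - pr P A.
  rewrite -prC // /induced_pmf /pr pre (asboolT (erefl : [set u1] u1)) (asboolF n10).
  by rewrite set0U.
have P_uw (P : probability X R) w : w != u0 -> w != u1 -> induced_pmf P phi w = 0.
  move=> w0 w1; have n0 : ~ [set w] u0 by move=> e; rewrite e eqxx in w0.
  have n1 : ~ [set w] u1 by move=> e; rewrite e eqxx in w1.
  by rewrite /induced_pmf pre (asboolF n0) (asboolF n1) setU0 measure0.
have comp : compatible (induced_pmf P0 phi) (induced_pmf P1 phi).
  have := allocation_compatible hf0 hf1 ac01 ac10 (allocation_rule hf0 hf1 qphi).
  by congr compatible; apply/funext => u; rewrite /total rule_massT.
have npq : induced_pmf P0 phi != induced_pmf P1 phi.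
  apply/eqP => /(congr1 (fun h => h u0)); rewrite !P_u0 => e.
  by move: qp; rewrite -/q -/p /q -e ltxx.
have inPhi : quantizer_class P0 P1 phi.
  split=> //; rewrite lt_neqAle kl_div_ge0 ?andbT //; last exact: compatible_sym.
    by apply: contra npq; rewrite eq_sym => /eqP /(kl_div_eq0 comp) ->.
  by apply: contra npq; rewrite eq_sym => /eqP /(kl_div_eq0 (compatible_sym comp)) ->.
have vle : pmf_var (induced_pmf P0 phi) (induced_llr P0 P1 phi) <= V0.
  by apply: ubV; exists phi.
have := @pmf_var_ge_binary R K (induced_pmf P0 phi) (induced_llr P0 P1 phi) u0 u1 u01.
rewrite P_u0 P_u1 -/p => /(_ (fun=> fine_ge0 (measure_ge0 _ _)) erefl (P_uw P0)).
move=> /le_trans /(_ vle).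
rewrite /induced_llr !P_u0 !P_u1 -/p -/q => le.
have l0 : ln (q / p) <= ln b.
  by rewrite ler_ln ?posrE ?divr_gt0 // ler_pdivrMr.
have l1 : 0 <= ln ((1 - q) / (1 - p)).
  by rewrite ln_ge0 // ler_pdivlMr; lra.
have lb : ln b < 0 by rewrite ln_lt0 // b0 b1.
have sq : ln b ^+ 2 <= (ln (q / p) - ln ((1 - q) / (1 - p))) ^+ 2.
  rewrite -[X in X <= _]sqrrN -[X in _ <= X]sqrrN ler_sqr ?nnegrE; lra.
have h4 : 4^-1 <= (1 - p) ^+ 2.
  rewrite (_ : 4^-1 = 2^-1 ^+ 2 :> R); last by field.
  by rewrite ler_sqr ?nnegrE; lra.
have : p * 4^-1 * ln b ^+ 2 <= V0.
  apply: le_trans le; apply: ler_pM => //; rewrite ?sqr_ge0 //.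
    by rewrite mulr_ge0 // ltW.
  by rewrite ler_pM2l.
lra.
Qed.

(** A small label contributes little to the divergence, uniformly over all
    allocations: by the tail bound most of its mass sits where the ratio is not
    too small. *)
Lemma small_label (eta : R) : 0 < eta -> exists2 dl, 0 < dl &
  forall n0 n1 u, allocation P0 P1 f0 f1 n0 n1 -> @total d X R K n0 u <= dl ->
    kl_term (total n0 u) (total n1 u) <= eta.
Proof.
move=> eta0; have [V [c [V0 c0 tail]]] := low_ratio_tail.
have [mf0 f00 _] := hf0; have [mf1 f10 _] := hf1.
pose l := `|ln c| + 1.
have l0 : 0 < l by rewrite ltr_pwDr.
pose dl := Num.min (eta / 2) (Num.min (eta ^+ 2 / (8 * V)) (eta / (2 * l))).
have dl0 : 0 < dl by rewrite !lt_min !divr_gt0 ?exprn_gt0 ?mulr_gt0.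
exists dl => // n0 n1 u h; have [h0 h1 r _] := h.
have comp := allocation_compatible hf0 hf1 ac01 ac10 h.
rewrite !le_min => /andP[pe /andP[pV pl]].
have [p0|p0] := eqVneq (total n0 u) 0; first by rewrite p0 /kl_term mul0r ltW.
have [pgt qgt] := compatible_gt0 comp p0.
set p := total n0 u in pe pV pl pgt *; set q := total n1 u in qgt *.
pose s := eta / (2 * p).
have s0 : 0 < s by rewrite divr_gt0 // mulr_gt0.
have ls : l <= s.
  move: pl; rewrite ler_pdivlMr ?mulr_gt0 // => pl.
  by rewrite ler_pdivlMr ?mulr_gt0 //; lra.
pose b := expR (- s).
have b0 : 0 < b by exact: expR_gt0.
have lnb : ln b = - s by rewrite /b expRK.
have bc : b <= c.
  rewrite -ler_ln ?posrE // lnb.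
  by have := ler_norm (- ln c); rewrite normrN /l in ls *; lra.
set A := [set x | 1 * f1 x < b * f0 x].
have mA : measurable A by exact: measurable_ratio_lt.
have mAC : measurable (~` A) by exact: measurableC.
have pA : n0 u A <= p / 2.
  apply: le_trans (allots_le_pr h0 u mA) _.
  have := tail b b0 bc; rewrite -/A lnb sqrrN => t.
  have s20 : 0 < s ^+ 2 by rewrite exprn_gt0.
  rewrite -(ler_pM2r s20); apply: le_trans t _.
  rewrite /s (_ : p / 2 * (eta / (2 * p)) ^+ 2 = eta ^+ 2 / (8 * p)); last first.
    by field; rewrite gt_eqF.
  rewrite ler_pdivlMr ?mulr_gt0 //; move: pV; rewrite ler_pdivlMr ?mulr_gt0 //; lra.
have pAC : p / 2 <= n0 u (~` A).
  have : p = n0 u A + n0 u (~` A).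
    by rewrite /p /total (allots_split h0 _ measurableT mA) setTI setTD.
  by lra.
have qAC : b * (p / 2) <= q.
  apply: (@le_trans _ _ (b * n0 u (~` A))); first by rewrite ler_pM2l.
  apply: (@le_trans _ _ (1 * n1 u (~` A))).
    by apply: r => //; [exact: ltW|move=> x /negP; rewrite -leNgt].
  by rewrite mul1r; apply: (allots_le h1).
have : ln (p / q) <= ln 2 + s.
  have -> : ln 2 + s = ln (2 / b) by rewrite ln_div ?posrE // lnb opprK.
  rewrite ler_ln ?posrE ?divr_gt0 //.
  by rewrite ler_pdivrMr // mulrAC ler_pdivlMr //; lra.
have ln2 : ln 2 <= 1 :> R.
  by apply: le_trans (ln_le_sub1 _) _; lra.
move=> lpq; rewrite /kl_term.
apply: (@le_trans _ _ (p * (1 + s))); first by rewrite ler_pM2l //; lra.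
rewrite mulrDr mulr1 (_ : p * s = eta / 2); last by rewrite /s; field; rewrite gt_eqF.
by lra.
Qed.

End Tails.

(** * Limits of allocations *)

Lemma ultra_bounded_cvg (R : realType) (U : set_system nat) (x : nat -> R) :
  UltraFilter U -> (forall k, 0 <= x k <= 1) -> exists l : R, x k @[k --> U] --> l.
Proof.
move=> UU x01; have PF : ProperFilter (x @ U) by exact: fmap_proper_filter.
have [] := @segment_compact R 0 1 (x @ U) PF.
  by apply: nearW => k /=; rewrite in_itv /= x01.
move=> l [_ cl]; exists l => N Nl.
have [//|UN] := in_ultra_setVsetC (x @^-1` N) UU.
by have [y [nNy Ny]] := cl (~` N) N UN Nl.
Qed.

Section Limits.
Context {d : measure_display} {X : measurableType d} {R : realType} {K : nat}.
Context {U : set_system nat} {PF : ProperFilter U}.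
Implicit Types (n : nat -> 'I_K -> set X -> R) (nl : 'I_K -> set X -> R).

Definition converges n nl : Prop :=
  forall u A, measurable A -> n k u A @[k --> U] --> nl u A.

Lemma allots_limit (P : probability X R) n nl :
  (forall k, allots P (n k)) -> converges n nl -> allots P nl.
Proof.
move=> h c; split=> [u A mA|u A B mA mB AB|A mA].
- apply: (ler_cvg_to (cvg_cst 0) (c u A mA)).
  by apply: nearW => k; exact: (allots_ge0 (h k)).
- apply: (norm_cvg_unique (c u _ (measurableU _ _ mA mB))).
  rewrite (_ : (fun k => n k u (A `|` B)) = (fun k => n k u A + n k u B)).
    by apply: cvgD; exact: c.
  by apply/funext => k; rewrite (allotsU (h k)).
- have : (\sum_u n k u A) @[k --> U] --> \sum_u nl u A.
    by apply: cvg_big => [|u _]; [exact: add_continuous|exact: c].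
  move=> cs; apply: (norm_cvg_unique cs).
  rewrite (_ : (fun k => \sum_u n k u A) = cst (pr P A)); first exact: cvg_cst.
  by apply/funext => k; rewrite (allots_sum (h k)).
Qed.

Lemma ratio_respecting_limit (f f' : X -> R) n n' nl nl' :
  (forall k, ratio_respecting f f' (n k) (n' k)) -> converges n nl -> converges n' nl' ->
  ratio_respecting f f' nl nl'.
Proof.
move=> h c c' u a b A a0 b0 mA le.
have ca : a * n k u A @[k --> U] --> a * nl u A by apply: cvgMr; exact: c.
have cb : b * n' k u A @[k --> U] --> b * nl' u A by apply: cvgMr; exact: c'.
by apply: (ler_cvg_to ca cb); apply: nearW => k; exact: h.
Qed.

Lemma allocation_limit (P0 P1 : probability X R) (f0 f1 : X -> R) n0 n1 nl0 nl1 :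
  (forall k, allocation P0 P1 f0 f1 (n0 k) (n1 k)) ->
  converges n0 nl0 -> converges n1 nl1 -> allocation P0 P1 f0 f1 nl0 nl1.
Proof.
move=> h c0 c1; split.
- by apply: (allots_limit _ c0) => k; case: (h k).
- by apply: (allots_limit _ c1) => k; case: (h k).
- by apply: (ratio_respecting_limit _ c0 c1) => k; case: (h k).
- by apply: (ratio_respecting_limit _ c1 c0) => k; case: (h k).
Qed.

End Limits.

(** Compactness of the set of allocations: all the masses, being bounded, converge
    simultaneously along an ultrafilter. *)
Lemma allots_cluster (d : measure_display) (X : measurableType d) (R : realType) (K : nat)
    (P : probability X R) (U : set_system nat) (n : nat -> 'I_K -> set X -> R) :
  UltraFilter U -> (forall k, allots P (n k)) -> exists nl, @converges d X R K U n nl.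
Proof.
move=> UU h.
have ex u A : exists l : R, measurable A -> n k u A @[k --> U] --> l.
  have [mA|nmA] := pselect (measurable A); last by exists 0.
  have n01 k : 0 <= n k u A <= 1.
    by rewrite (allots_ge0 (h k)) //= (le_trans (allots_le_pr (h k) u mA)) // pr_le1.
  by have [l hl] := ultra_bounded_cvg UU n01; exists l.
exists (fun u A => projT1 (cid (ex u A))) => u A mA.
exact: (projT2 (cid (ex u A))).
Qed.

Lemma cvg_kl_term (R : realType) (T : Type) (F : set_system T) (FF : Filter F)
    (x y : T -> R) (p q : R) : 0 < p -> 0 < q ->
  x @ F --> p -> y @ F --> q -> kl_term (x t) (y t) @[t --> F] --> kl_term p q.
Proof.
move=> p0 q0 xp yq; apply: cvgM => //.
have xy : (x t / y t) @[t --> F] --> p / q.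
  by apply: cvgM => //; apply: cvgV => //; rewrite gt_eqF.
by apply: (cvg_comp _ _ xy); apply: continuous_ln; rewrite divr_gt0.
Qed.

Section UpperSemicontinuity.
Context {d : measure_display} {X : measurableType d} {R : realType} {K : nat}.
Context {mu : {measure set X -> \bar R}} {P0 P1 : probability X R} {f0 f1 : X -> R}.
Hypotheses (hf0 : is_density mu P0 f0) (hf1 : is_density mu P1 f1).
Hypotheses (ac01 : P0 `<< P1) (ac10 : P1 `<< P0).
Hypothesis hK : (2 <= K)%N.
Hypothesis var0 : bounded_llr_variance P0 P1 (@quantizer_class d X R K P0 P1) P0.
Context {U : set_system nat} {PF : ProperFilter U}.

(** Upper semicontinuity of the divergence. The summands of positive limiting mass
    converge; the other ones are eventually small by [small_label]. *)
Lemma kl_div_limit_le (n0 n1 : nat -> 'I_K -> set X -> R) nl0 nl1 (eta : R) :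
  (forall k, allocation P0 P1 f0 f1 (n0 k) (n1 k)) ->
  converges (U := U) n0 nl0 -> converges (U := U) n1 nl1 -> 0 < eta ->
  \forall k \near U, kl_div (total (n0 k)) (total (n1 k))
    <= kl_div (total nl0) (total nl1) + eta.
Proof.
move=> h cv0 cv1 eta0.
have K0 : 0 < K%:R :> R by rewrite ltr0n; exact: ltnW.
have hl : allocation P0 P1 f0 f1 nl0 nl1 by exact: allocation_limit h cv0 cv1.
have comp := allocation_compatible hf0 hf1 ac01 ac10 hl.
have e0 : 0 < eta / K%:R by rewrite divr_gt0.
have term u : \forall k \near U, kl_term (total (n0 k) u) (total (n1 k) u)
    <= kl_term (total nl0 u) (total nl1 u) + eta / K%:R.
  have c0 := cv0 u _ measurableT; have c1 := cv1 u _ measurableT.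
  have [z|nz] := eqVneq (total nl0 u) 0; last first.
    have [p0 q0] := compatible_gt0 comp nz.
    have ct : kl_term (total (n0 k) u) (total (n1 k) u) @[k --> U] -->
        kl_term (total nl0 u) (total nl1 u) by exact: cvg_kl_term p0 q0 c0 c1.
    by apply: (cvgr_le _ ct); rewrite ltrDl.
  have [dl dl0 small] := small_label hf0 hf1 ac01 ac10 hK var0 e0.
  have : \forall k \near U, n0 k u setT <= dl.
    by apply: (cvgr_le _ c0); rewrite -/(total nl0 u) z.
  apply: filterS => k le; rewrite z [kl_term 0 _]/kl_term mul0r add0r.
  exact: small (h k) le.
apply: filterS (filter_forall _ term) => k le.
have -> : eta = \sum_(u < K) eta / K%:R.
  by rewrite sumr_const card_ord -[RHS]mulr_natr divfK // gt_eqF.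
by rewrite !kl_divE -big_split /=; apply: ler_sum => u _; exact: le.
Qed.

End UpperSemicontinuity.

(** * Existence of an optimal design *)

Section Designs.
Context {d : measure_display} {X : measurableType d} {R : realType} {K : nat}.
Context {mu : {measure set X -> \bar R}} {P0 P1 : probability X R} {f0 f1 : X -> R}.
Hypotheses (hf0 : is_density mu P0 f0) (hf1 : is_density mu P1 f1).
Hypotheses (ac01 : P0 `<< P1) (ac10 : P1 `<< P0).
Hypothesis hK : (2 <= K)%N.
Hypothesis var0 : bounded_llr_variance P0 P1 (@quantizer_class d X R K P0 P1) P0.
Hypothesis var1 : bounded_llr_variance P0 P1 (@quantizer_class d X R K P0 P1) P1.
Context {c0 c1 : R} (c0_gt0 : 0 < c0) (c1_gt0 : 0 < c1) {T : nat}.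
Implicit Types n m : 'I_T -> 'I_K -> set X -> R.

Definition design n0 n1 : Prop := forall t, allocation P0 P1 f0 f1 (n0 t) (n1 t).

Definition total_div n0 n1 : R := \sum_t kl_div (total (n0 t)) (total (n1 t)).

Definition design_cost n0 n1 : R := c0 / total_div n0 n1 + c1 / total_div n1 n0.

Definition nondegenerate n0 n1 : Prop :=
  [/\ design n0 n1, 0 < total_div n0 n1 & 0 < total_div n1 n0].

Lemma total_div_ge0 n0 n1 : design n0 n1 -> 0 <= total_div n0 n1.
Proof.
move=> h; apply: sumr_ge0 => t _; apply: kl_div_ge0.
exact: (allocation_compatible hf0 hf1 ac01 ac10 (h t)).
Qed.

Lemma total_div_sym_ge0 n0 n1 : design n0 n1 -> 0 <= total_div n1 n0.
Proof.
move=> h; apply: sumr_ge0 => t _; apply: kl_div_ge0; apply: compatible_sym.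
exact: (allocation_compatible hf0 hf1 ac01 ac10 (h t)).
Qed.

(** A bound that holds with an arbitrarily small loss in both denominators holds
    without loss, and the denominators do not vanish. *)
Lemma cost_le_of_slack (S0 S1 b : R) : 0 <= S0 -> 0 <= S1 ->
  (forall e : R, 0 < e -> c0 / (S0 + e) + c1 / (S1 + e) <= b + e) ->
  [/\ 0 < S0, 0 < S1 & c0 / S0 + c1 / S1 <= b].
Proof.
move=> S0p S1p H.
have pos (S S' c c' : R) : 0 <= S -> 0 <= S' -> 0 < c -> 0 < c' ->
    (forall e : R, 0 < e -> c / (S + e) + c' / (S' + e) <= b + e) -> 0 < S.
  move=> Sp Sp' cp cp' h; rewrite lt_neqAle Sp andbT eq_sym; apply/eqP => S00.
  pose e := Num.min 1 (c / (`|b| + 2)).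
  have b2 : 0 < `|b| + 2 by rewrite ltr_wpDl.
  have e0 : 0 < e by rewrite lt_min ltr01 divr_gt0.
  have e1 : e <= 1 by rewrite ge_min lexx.
  have ce : `|b| + 2 <= c / e.
    by rewrite ler_pdivlMr // mulrC -ler_pdivlMr // ge_min lexx orbT.
  have := h e e0; rewrite S00 add0r.
  have : 0 <= c' / (S' + e) by rewrite divr_ge0 ?ltW // ltr_wpDl.
  have := ler_norm b; lra.
have S00 := pos S0 S1 c0 c1 S0p S1p c0_gt0 c1_gt0 H.
have S10 : 0 < S1.
  apply: (pos S1 S0 c1 c0) => // e e0; rewrite addrC; exact: H.
split=> //; rewrite leNgt; apply/negP => lt.
have gap (S c e : R) : 0 < S -> 0 < c -> 0 < e -> c / S - c / S ^+ 2 * e <= c / (S + e).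
  move=> Sp cp ep; have Se : 0 < S + e by exact: addr_gt0.
  rewrite -subr_ge0 (_ : _ - _ = c * e ^+ 2 / (S ^+ 2 * (S + e))); last first.
    by field; rewrite !gt_eqF.
  by rewrite divr_ge0 ?mulr_ge0 ?sqr_ge0 // ltW.
pose k := c0 / S0 ^+ 2 + c1 / S1 ^+ 2 + 1.
have k0 : 0 < k.
  by rewrite /k; apply: addr_gt0 => //; apply: addr_gt0; apply: divr_gt0 => //; exact: exprn_gt0.
pose e := (c0 / S0 + c1 / S1 - b) / (2 * k).
have e0 : 0 < e by rewrite /e divr_gt0 ?subr_gt0 // mulr_gt0.
have ke : k * e = (c0 / S0 + c1 / S1 - b) / 2.
  by rewrite /e; field; rewrite !gt_eqF.
have := H e e0; have := gap S0 c0 e S00 c0_gt0 e0; have := gap S1 c1 e S10 c1_gt0 e0.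
move: ke lt; rewrite /k; lra.
Qed.

(** A minimising sequence has a limit along an ultrafilter, and the divergences of
    the limit are at least those of the sequence, up to any slack. *)
Lemma exists_optimal_design (m0 m1 : 'I_T -> 'I_K -> set X -> R) :
  nondegenerate m0 m1 ->
  exists n0 n1, nondegenerate n0 n1 /\
    forall w0 w1, nondegenerate w0 w1 -> design_cost n0 n1 <= design_cost w0 w1.
Proof.
move=> hm.
pose V := [set x : R | exists n0 n1, nondegenerate n0 n1 /\ design_cost n0 n1 = x].
have Vlb : has_lbound V.
  exists 0 => _ [n0 [n1 [[_ p0 p1] <-]]].
  by rewrite addr_ge0 // divr_ge0 // ltW.
have Vinf : has_inf V by split=> //; exists (design_cost m0 m1), m0, m1.
have ex k : exists nn : ('I_T -> 'I_K -> set X -> R) * ('I_T -> 'I_K -> set X -> R),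
    nondegenerate nn.1 nn.2 /\ design_cost nn.1 nn.2 < inf V + k.+1%:R^-1.
  have k0 : 0 < k.+1%:R^-1 :> R by rewrite invr_gt0.
  have [_ [n0 [n1 [hn <-]]] lt] := inf_adherent k0 Vinf.
  by exists (n0, n1).
pose sq k := projT1 (cid (ex k)).
have sqP k : nondegenerate (sq k).1 (sq k).2 /\
   design_cost (sq k).1 (sq k).2 < inf V + k.+1%:R^-1 := projT2 (cid (ex k)).
have [U [UU Uoo]] := @ultraFilterLemma nat \oo _.
have PU : ProperFilter U by exact: ultra_proper.
have hd k : design (sq k).1 (sq k).2 by have [[]] := sqP k.
have cl0 t : exists nl, converges (U := U) (fun k => (sq k).1 t) nl.
  by apply: (@allots_cluster _ _ _ _ P0) => // k; have [] := hd k t.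
have cl1 t : exists nl, converges (U := U) (fun k => (sq k).2 t) nl.
  by apply: (@allots_cluster _ _ _ _ P1) => // k; have [] := hd k t.
pose n0 t := projT1 (cid (cl0 t)); pose n1 t := projT1 (cid (cl1 t)).
have cv0 t : converges (U := U) (fun k => (sq k).1 t) (n0 t) := projT2 (cid (cl0 t)).
have cv1 t : converges (U := U) (fun k => (sq k).2 t) (n1 t) := projT2 (cid (cl1 t)).
have hn : design n0 n1.
  by move=> t; apply: (allocation_limit _ (cv0 t) (cv1 t)) => k; exact: hd.
have eT (e : R) : 0 < e -> 0 < e / T.+1%:R by move=> e0; rewrite divr_gt0.
have sumT (e : R) : 0 < e -> \sum_(t < T) e / T.+1%:R <= e.
  move=> e0; rewrite sumr_const card_ord -[X in X <= _]mulr_natr.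
  by rewrite mulrAC ler_pdivrMr // ler_pM2l // ler_nat.
have le0 e : 0 < e -> \forall k \near U,
    total_div (sq k).1 (sq k).2 <= total_div n0 n1 + e.
  move=> e0.
  have H t : \forall k \near U, kl_div (total ((sq k).1 t)) (total ((sq k).2 t))
      <= kl_div (total (n0 t)) (total (n1 t)) + e / T.+1%:R.
    exact: (kl_div_limit_le hf0 hf1 ac01 ac10 hK var0
      (fun k => hd k t) (cv0 t) (cv1 t) (eT e e0)).
  apply: filterS (filter_forall _ H) => k le.
  apply: (le_trans (ler_sum _ (fun t _ => le t))).
  by rewrite big_split /= lerD2l sumT.
have le1 e : 0 < e -> \forall k \near U,
    total_div (sq k).2 (sq k).1 <= total_div n1 n0 + e.
  move=> e0.
  have H t : \forall k \near U, kl_div (total ((sq k).2 t)) (total ((sq k).1 t))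
      <= kl_div (total (n1 t)) (total (n0 t)) + e / T.+1%:R.
    exact: (kl_div_limit_le hf1 hf0 ac10 ac01 hK (bounded_llr_varianceC var1)
      (fun k => allocation_sym (hd k t)) (cv1 t) (cv0 t) (eT e e0)).
  apply: filterS (filter_forall _ H) => k le.
  apply: (le_trans (ler_sum _ (fun t _ => le t))).
  by rewrite big_split /= lerD2l sumT.
have slack e : 0 < e ->
    c0 / (total_div n0 n1 + e) + c1 / (total_div n1 n0 + e) <= inf V + e.
  move=> e0.
  have lek : \forall k \near U, k.+1%:R^-1 <= e.
    by apply: Uoo; apply: filterS (near_infty_natSinv_lt (PosNum e0)) => k /ltW.
  have [k [[l0 l1] lk]] : exists k, (total_div (sq k).1 (sq k).2 <= total_div n0 n1 + e
     /\ total_div (sq k).2 (sq k).1 <= total_div n1 n0 + e) /\ k.+1%:R^-1 <= e.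
    by apply: (@filter_ex _ U); apply: filterI => //; apply: filterI; [exact: le0|exact: le1].
  have [[_ p0 p1] cost] := sqP k.
  apply: (@le_trans _ _ (design_cost (sq k).1 (sq k).2)).
    apply: lerD; rewrite ler_pM2l // lef_pV2 //.
      exact: lt_le_trans p0 l0.
    exact: lt_le_trans p1 l1.
  by apply: le_trans (ltW cost) _; rewrite lerD2l.
have [S0 S1 le] := cost_le_of_slack (total_div_ge0 hn) (total_div_sym_ge0 hn) slack.
exists n0, n1; split=> // w0 w1 hw; apply: le_trans le _.
by apply: ge_inf => //; exists w0, w1.
Qed.

End Designs.

(** * Designs of threshold rules *)

Lemma sumr_gt0_ord (R : realType) (T : nat) (F : 'I_T -> R) : (0 < T)%N ->
  (forall t, 0 < F t) -> 0 < \sum_t F t.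
Proof.
move=> T0 F0; rewrite (bigD1 (Ordinal T0)) //= ltr_pwDl // sumr_ge0 // => t _.
exact: ltW.
Qed.

Section DesignOfThresholds.
Context {d : measure_display} {X : measurableType d} {R : realType} {K' : nat}.
Local Notation K := K'.+1.
Context {mu : {measure set X -> \bar R}} {P0 P1 : probability X R} {f0 f1 : X -> R}.
Hypotheses (hf0 : is_density mu P0 f0) (hf1 : is_density mu P1 f1).
Hypotheses (ac01 : P0 `<< P1) (ac10 : P1 `<< P0).
Context {c0 c1 : R} (c0_gt0 : 0 < c0) (c1_gt0 : 0 < c1) {T : nat}.

Lemma total_rule_mass (P : probability X R) (phi : X -> 'I_K) :
  total (rule_mass P phi) = induced_pmf P phi.
Proof. by apply/funext => u; exact: rule_massT. Qed.

(** If one divergence vanished then so would the other one, and any rule of positive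
    divergences would be strictly better. *)
Lemma optimal_div_gt0 (d0 d1 : R) (n0 n1 : 'I_K -> set X -> R) (phi : X -> 'I_K) :
  0 <= d0 -> 0 <= d1 -> quantizer_class P0 P1 phi ->
  @optimal _ _ _ _ P0 P1 f0 f1 c0 c1 d0 d1 n0 n1 ->
  0 < kl_div (total n0) (total n1) /\ 0 < kl_div (total n1) (total n0).
Proof.
move=> d00 d10 [q phi0 phi1] [h D0 D1 best].
have comp := allocation_compatible hf0 hf1 ac01 ac10 h.
have comp' := compatible_sym comp.
have ne : total n0 != total n1.
  apply/eqP => e.
  have kl0 : kl_div (total n0) (total n1) = 0 /\ kl_div (total n1) (total n0) = 0.
    have z p : kl_div p p = 0 :> R.
      rewrite kl_divE big1 // => u _; rewrite /kl_term.
      by have [->|pu] := eqVneq (p u) 0; rewrite ?mul0r // divff // ln1 mulr0.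
    by rewrite e; split; exact: z.
  move: D0 D1 best; rewrite /cost /den0 /den1 kl0.1 kl0.2 !addr0 => D0 D1 best.
  have := best _ _ (allocation_rule hf0 hf1 q).
  rewrite !total_rule_mass -/(div0 P0 P1 phi) -/(div1 P0 P1 phi).
  have p0 : 0 < d0 + div0 P0 P1 phi by exact: addr_gt0.
  have p1 : 0 < d1 + div1 P0 P1 phi by exact: addr_gt0.
  move=> /(_ p0 p1); apply/negP; rewrite -ltNge.
  by apply: ltrD; rewrite ltr_pM2l // ltf_pV2 // ltrDl.
split; rewrite lt_neqAle kl_div_ge0 // andbT eq_sym.
  by apply: contra ne => /eqP /(kl_div_eq0 comp) ->.
by apply: contra ne => /eqP /(kl_div_eq0 comp') ->.
Qed.

Lemma design_component_optimal (n0 n1 : 'I_T -> 'I_K -> set X -> R) (t : 'I_T) :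
  nondegenerate (P0 := P0) (P1 := P1) (f0 := f0) (f1 := f1) n0 n1 ->
  (forall w0 w1 : 'I_T -> 'I_K -> set X -> R, nondegenerate (P0 := P0) (P1 := P1) (f0 := f0) (f1 := f1) w0 w1 ->
     design_cost (c0 := c0) (c1 := c1) n0 n1 <= design_cost (c0 := c0) (c1 := c1) w0 w1) ->
  @optimal _ _ _ _ P0 P1 f0 f1 c0 c1
    (\sum_(s | s != t) kl_div (total (n0 s)) (total (n1 s)))
    (\sum_(s | s != t) kl_div (total (n1 s)) (total (n0 s))) (n0 t) (n1 t).
Proof.
move=> [hd S0 S1] best.
pose upd (n : 'I_T -> 'I_K -> set X -> R) m s := if s == t then m else n s.
have updE (n n' : 'I_T -> 'I_K -> set X -> R) m m' : total_div (upd n m) (upd n' m') =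
    (\sum_(s | s != t) kl_div (total (n s)) (total (n' s))) + kl_div (total m) (total m').
  rewrite /total_div (bigD1 t) //= /upd eqxx addrC; congr (_ + _).
  by apply: eq_bigr => s /negbTE ->.
have updT (n : 'I_T -> 'I_K -> set X -> R) : upd n (n t) = n.
  by apply/funext => s; rewrite /upd; case: eqP => [->|].
have e0 := updE n0 n1 (n0 t) (n1 t); have e1 := updE n1 n0 (n1 t) (n0 t).
rewrite !updT in e0 e1.
split; rewrite ?/cost /den0 /den1 -?e0 -?e1 //.
move=> m0 m1 hm; rewrite -!updE => p0 p1.
apply: best; split=> // s; rewrite /upd; case: eqP => [_|_]; [exact: hm|exact: hd].
Qed.

End DesignOfThresholds.

Theorem theorem9 (R : realType) (d : measure_display) (X : measurableType d)
    (mu : {measure set X -> \bar R}) (P0 P1 : probability X R) (f0 f1 : X -> R)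
    (hf0 : is_density mu P0 f0) (hf1 : is_density mu P1 f1)
    (P0_ac_P1 : P0 `<< P1) (P1_ac_P0 : P1 `<< P0)
    (K : nat) (hK : (2 <= K)%N)
    (Phi_neq0 : @quantizer_class d X R K P0 P1 !=set0)
    (var0 : bounded_llr_variance P0 P1 (@quantizer_class d X R K P0 P1) P0)
    (var1 : bounded_llr_variance P0 P1 (@quantizer_class d X R K P0 P1) P1)
    (pi0 pi1 : R) (hpi0 : 0 < pi0 < 1) (hpi1 : 0 < pi1 < 1)
    (hpi : pi0 + pi1 = 1)
    (T : nat) (hT : (1 <= T)%N) :
  exists phi : nat -> X -> 'I_K,
    asymptotically_optimal P0 P1 pi0 pi1 T
      (blockwise_stationary T (quantizer_class P0 P1)) phi /\
    forall n, lr_threshold_rule P0 f0 f1 (phi n).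
Proof.
case: K hK Phi_neq0 var0 var1 => // K' hK [psi psi_in] var0 var1.
have T0 : 0 < T%:R :> R by rewrite ltr0n.
have c0_gt0 : 0 < T%:R * pi0 by rewrite mulr_gt0 //; case/andP: hpi0.
have c1_gt0 : 0 < T%:R * pi1 by rewrite mulr_gt0 //; case/andP: hpi1.
pose masses (P : probability X R) (phi : nat -> X -> 'I_K'.+1) (t : 'I_T) := rule_mass P (phi t).
have masses_div (P P' : probability X R) phi : total_div (masses P phi) (masses P' phi) =
    \sum_(t < T) kl_div (induced_pmf P (phi t)) (induced_pmf P' (phi t)).
  by apply: eq_bigr => t _; rewrite !total_rule_mass.
have masses_nondeg phi : (forall n, quantizer_class P0 P1 (phi n)) ->
    nondegenerate (P0 := P0) (P1 := P1) (f0 := f0) (f1 := f1)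
      (masses P0 phi) (masses P1 phi).
  move=> hphi; split; rewrite ?masses_div.
  - by move=> t; apply: (allocation_rule hf0 hf1); case: (hphi t).
  - by apply: sumr_gt0_ord => // t; case: (hphi t).
  - by apply: sumr_gt0_ord => // t; case: (hphi t).
have [n0 [n1 [nondeg best]]] := exists_optimal_design hf0 hf1 P0_ac_P1 P1_ac_P0 hK
  var0 var1 c0_gt0 c1_gt0 (masses_nondeg (fun=> psi) (fun=> psi_in)).
have [hd _ _] := nondeg.
have comp t := allocation_compatible hf0 hf1 P0_ac_P1 P1_ac_P0 (hd t).
have ex t : exists phi : X -> 'I_K'.+1, [/\ quantizer_class P0 P1 phi,
    lr_threshold_rule P0 f0 f1 phi, div0 P0 P1 phi = kl_div (total (n0 t)) (total (n1 t)) &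
    div1 P0 P1 phi = kl_div (total (n1 t)) (total (n0 t))].
  have o := design_component_optimal t nondeg best.
  have r0 : 0 <= \sum_(s | s != t) kl_div (total (n0 s)) (total (n1 s)).
    by apply: sumr_ge0 => s _; exact: kl_div_ge0.
  have r1 : 0 <= \sum_(s | s != t) kl_div (total (n1 s)) (total (n0 s)).
    by apply: sumr_ge0 => s _; exact/kl_div_ge0/compatible_sym.
  have [phi [q thr e0 e1]] := optimal_threshold hf0 hf1 P0_ac_P1 P1_ac_P0
    c0_gt0 c1_gt0 r0 r1 o.
  have [p0 p1] := optimal_div_gt0 hf0 hf1 P0_ac_P1 P1_ac_P0 c0_gt0 c1_gt0 r0 r1 psi_in o.
  by exists phi; split; [split; rewrite ?e0 ?e1| | |].
pose rule t := projT1 (cid (ex t)).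
have ruleP t : [/\ quantizer_class P0 P1 (rule t),
    lr_threshold_rule P0 f0 f1 (rule t),
    div0 P0 P1 (rule t) = kl_div (total (n0 t)) (total (n1 t)) &
    div1 P0 P1 (rule t) = kl_div (total (n1 t)) (total (n0 t))] := projT2 (cid (ex t)).
pose phi n := rule (Ordinal (ltn_pmod n hT)).
have phiE (t : 'I_T) : phi t = rule t.
  by congr rule; apply: val_inj; rewrite /= modn_small.
exists phi; split; last by move=> n; case: (ruleP (Ordinal (ltn_pmod n hT))).
split; first split.
- by move=> n; congr rule; apply: val_inj; rewrite /= modnDr.
- by move=> n; case: (ruleP (Ordinal (ltn_pmod n hT))).
move=> w [_ w_in].
have -> : cost_coef P0 P1 pi0 pi1 T phi
    = design_cost (c0 := T%:R * pi0) (c1 := T%:R * pi1) n0 n1.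
  rewrite /cost_coef /design_cost /total_div.
  by congr (_ / _ + _ / _); apply: eq_bigr => t _; rewrite phiE; case: (ruleP t).
apply: le_trans (best _ _ (masses_nondeg w w_in)) _.
by rewrite /design_cost !masses_div.
Qed.
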